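(* Let $\phi$ be a dgf on $\mathbb R^n$, $X=\operatorname{dom}\phi$, $Y=\operatorname{int}\operatorname{dom}\phi$, $Y_*=\operatorname{int}\operatorname{dom}\phi^*$. For any $\lambda>0$, $f:X\to\overline{\mathbb R}$ and $g:Y\to\overline{\mathbb R}$ the following hold: (i) $\overleftarrow{\partial}_{\lambda}f=\bigl[\partial_F(f+\lambda^{-1}\phi)\bigr]\big|_{\operatorname{int}X}-\lambda^{-1}\nabla\phi\subseteq\hat\partial f$. (ii) $\overleftarrow{\mathrm{prox}}_{\lambda f}=\partial_F(\phi+\lambda f)^{-1}\circ\nabla\phi$. (iii) $\operatorname{int}X\cap\overleftarrow{\mathrm{prox}}_{\lambda f}=\bigl(\nabla\phi+\lambda\overleftarrow{\partial}_{\lambda}f\bigr)^{-1}\circ\nabla\phi$. (iv) $\overrightarrow{\mathrm{prox}}_{\lambda g}=\bigl(\mathrm{id}+\lambda\overrightarrow{\partial}_{\lambda}g\bigr)^{-1}\big|_{X}$. If $\phi$ is Legendre, then the following also hold: (v) $\overrightarrow{\partial}_{\lambda}g=\partial_F(g\circ\nabla\phi^*+\lambda^{-1}\phi^* )-\lambda^{-1}\nabla\phi^*\subseteq\hat\partial[g\circ\nabla\phi^*]$. (vi) $\overrightarrow{\mathrm{prox}}_{\lambda g}=\partial_F(\phi^*+\lambda\, g\circ\nabla\phi^* )^{-1}$. (vii) $\overleftarrow{\mathrm{prox}}_{\lambda f}\circ\nabla\phi^*=\partial_F(\phi+\lambda f)^{-1}\big|_{Y_*}$ and $\overrightarrow{\mathrm{prox}}_{\lambda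 g}$ are monotone operators. (viii) $\overleftarrow{\mathrm{prox}}_{\lambda f}\circ\nabla\phi^*\subseteq\partial(\phi+\lambda\tilde f)^*\big|_{Y_*}=\nabla\phi^*+\lambda\,\partial\bigl[-\overleftarrow{\mathrm{env}}_\lambda f\circ\nabla\phi^*\bigr]$. When $\phi+\lambda\tilde f$ is lsc and convex, the inclusion holds as equality. If, additionally, $\phi$ is 1-coercive, then the following also holds: (ix) $\operatorname{conv}\overleftarrow{\mathrm{prox}}_{\lambda f}\circ\nabla\phi^*=\overleftarrow{\mathrm{prox}}_{\lambda\,\mathrm{hull}_\lambda f}\circ\nabla\phi^*$.
   Context: $\overline{\mathbb R}=[-\infty,\infty]$. A distance-generating function (dgf) is a proper, lsc, convex $\phi:\mathbb R^n\to\overline{\mathbb R}$ that is differentiable on $\operatorname{int}\operatorname{dom}\phi\neq\emptyset$. $X=\operatorname{dom}\phi$, $Y=\operatorname{int}\operatorname{dom}\phi$, $Y_*=\operatorname{int}\operatorname{dom}\phi^*$, with $\phi^*$ the convex conjugate; a superscript $*$ on a function on $\mathbb R^n$ always denotes its convex conjugate. $D_\phi(x,y)=\phi(x)-\phi(y)-\langle\nabla\phi(y),x-y\rangle$ if $y\in Y$, and $\infty$ otherwise. $\phi$ is Legendre if it is essentially smooth (differentiable on $Y\ne\emptyset$ with $\|\nabla\phi(x^k)\|\to\infty$ whenever $Y\ni x^k\to x\in\operatorname{bdry}\operatorname{dom}\phi$) and essentially strictly convex (strictly convex on every convex subset of $\operatorname{dom}\partial\phi$); then $\nabla\phi:Y\to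 Y_*$ is a bijection with inverse $\nabla\phi^*$. $\phi$ is 1-coercive if $\liminf_{\|x\|\to\infty}\phi(x)/\|x\|=\infty$. Sums such as $f+\lambda^{-1}\phi$ are functions on the set where $f$ is defined (so on $X$), and $\phi^*+\lambda g\circ\nabla\phi^*$ is a function on $Y_*$. $\tilde f:\mathbb R^n\to\overline{\mathbb R}$ equals $f$ on $X$ and $\infty$ elsewhere. For $h:S\to\overline{\mathbb R}$, $S\subseteq\mathbb R^n$, with all points and limits in $S$: Fenchel subdifferential $\partial_Fh(x)=\{u\in\mathbb R^n: h(x')\ge h(x)+\langle u,x'-x\rangle\ \forall x'\in S\}$; Fréchet subdifferential $\hat\partial h(x)=\{v\in\mathbb R^n:\liminf_{z\to x,z\ne x}\frac{h(z)-h(x)-\langle v,z-x\rangle}{\|z-x\|}\ge0\}$; limiting subdifferential $\partial h(x)=\{v:\exists (x^k,v^k)\in\operatorname{gph}\hat\partial h,\ (x^k,h(x^k),v^k)\to(x,h(x),v)\}$ for $x\in\operatorname{dom}h=\{h<\infty\}$, and $\emptyset$ otherwise. For $\bar y\in Y$ and $\bar x\in X$: $\overleftarrow{\mathrm{prox}}_{\lambda f}(\bar y)=\operatorname{argmin}_{x\in X}\{f(x)+\frac1\lambda D_\phi(x,\bar y)\}$, $\overleftarrow{\mathrm{env}}_\lambda f(\bar y)=\inf_{x\in X}\{f(x)+\frac1\lambda D_\phi(x,\bar y)\}$, $\overrightarrow{\mathrm{prox}}_{\lambda g}(\bar x)=\operatorname{argmin}_{y\in Y}\{g(y)+\frac1\lambda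 D_\phi(\bar x,y)\}$, $\overrightarrow{\mathrm{env}}_\lambda g(\bar x)=\inf_{y\in Y}\{g(y)+\frac1\lambda D_\phi(\bar x,y)\}$, $\mathrm{hull}_\lambda f=-\overrightarrow{\mathrm{env}}_\lambda(-\overleftarrow{\mathrm{env}}_\lambda f):X\to\overline{\mathbb R}$ (the left Bregman proximal hull). Left Bregman level proximal subdifferential $\overleftarrow{\partial}_\lambda f:X\rightrightarrows\mathbb R^n$: $\bar u\in\overleftarrow{\partial}_\lambda f(\bar x)$ iff $\bar x\in\operatorname{int}X$ and $f(x)\ge f(\bar x)+\langle\bar u,x-\bar x\rangle-\frac1\lambda D_\phi(x,\bar x)$ for all $x\in X$. Right one $\overrightarrow{\partial}_\lambda g:Y\rightrightarrows\mathbb R^n$: $\bar v\in\overrightarrow{\partial}_\lambda g(\bar y)$ iff $g(y)\ge g(\bar y)+\langle\bar v,\nabla\phi(y)-\nabla\phi(\bar y)\rangle-\frac1\lambda D_\phi(\bar y,y)$ for all $y\in Y$. Set-valued conventions: $T^{-1}(y)=\{x:y\in T(x)\}$, and $\partial_Fh^{-1}$, written $\partial_F(h)^{-1}$, is the inverse of the operator $\partial_Fh$; $T|_U$ equals $T$ on $U$ and $\emptyset$ off $U$; $(U\cap T)(x)=U\cap T(x)$; $\operatorname{conv}$ of an operator is the convex hull taken pointwise on its values; inclusions between operators are inclusions of graphs. $T$ is monotone if $\langle x-\bar x,y-\bar y\rangle\ge0$ for all $(x,y),(\bar x,\bar y)\in\operatorname{gph}T$.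
   Formalization: (v), (vi) and right-prox monotonicity in (vii) are stated via y=∇φ*(η), (vi) restricted to X; monotonicity and the equality in (viii) need f (resp. g) proper; the inclusion in (viii) needs f>-∞; in (ix) ⊆ is for all f, equality for f>-∞ with φ+λf̃ lsc and 1-coercive. *)

(* Defs.v *)
From HB Require Import structures.
From mathcomp Require Import all_boot all_order all_algebra.
From mathcomp Require Import all_classical all_reals all_analysis.

Set Implicit Arguments.
Unset Strict Implicit.
Unset Printing Implicit Defensive.

Import Order.TTheory GRing.Theory Num.Theory.
Import numFieldNormedType.Exports.

Local Open Scope classical_set_scope.
Local Open Scope ring_scope.

(* A function [h : S -> \bar R] on a subset [S] of R^n is represented by a
   total function together with the set [S]; values off [S] are never used.
   An operator R^n => R^n is a function [E -> set E], empty off its domain. *)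

Section SetValuedOperators.
Context {R : realType} {n : nat}.
Local Notation E := 'rV[R]_n.
Implicit Types (T S : E -> set E) (U : set E) (F : E -> E) (a : R).

Definition dot (u v : E) : R := (u *m v^T) 0 0.

(* The library norm on row vectors is the sup norm; this is the Euclidean one.
   Both induce the library topology. *)
Definition enorm (u : E) : R := Num.sqrt (dot u u).

Definition op_fun U F : E -> set E := fun x => [set u | U x /\ u = F x].
Definition op_id : E -> set E := fun x => [set x].
Definition op_inv T : E -> set E := fun y => [set x | T x y].
Definition op_restr T U : E -> set E := fun x => [set u | U x /\ T x u].
Definition op_cap U T : E -> set E := fun x => U `&` T x.
Definition op_comp T S : E -> set E := fun x => \bigcup_(y in S x) T y.
Definition op_add T S : E -> set E :=
  fun x => [set u + v | u in T x & v in S x].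
Definition op_scale a T : E -> set E := fun x => [set a *: u | u in T x].
Definition op_sub T S : E -> set E :=
  fun x => [set u - v | u in T x & v in S x].
Definition op_conv T : E -> set E := fun x => smallest (@convex_set R E) (T x).

Definition op_subset T S : Prop := forall x, T x `<=` S x.

Definition monotone_op T : Prop :=
  forall x y x' y', T x y -> T x' y' -> 0 <= dot (x - x') (y - y').

End SetValuedOperators.

Section ExtendedRealFunctions.
Context {R : realType} {n : nat}.
Local Notation E := 'rV[R]_n.
Implicit Types (h : E -> \bar R) (S : set E).
Local Open Scope ereal_scope.

Definition dom h : set E := [set x | h x < +oo].

Definition intdom h : set E := (dom h)°.

Definition proper_on S h : Prop :=
  (forall x, S x -> -oo < h x) /\ exists2 x, S x & h x < +oo.

Definition epigraph h : set (E * R^o) := [set p | h p.1 <= p.2%:E].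

(* Convexity of the epigraph makes sense for functions taking both infinite
   values. *)
Definition convex_ext h : Prop := convex_set (epigraph h).

Definition strictly_convex_on S h : Prop :=
  forall x y (t : R), S x -> S y -> x <> y -> (0 < t < 1)%R ->
    h (t *: x + (1 - t) *: y)%R < t%:E * h x + (1 - t)%:E * h y.

Definition conj_fun h : E -> \bar R :=
  fun u => ereal_sup [set (dot u x)%:E - h x | x in setT].

(* Only used at points near which [h] is finite. *)
Definition grad h : E -> E :=
  fun y => (\row_i 'd (fine \o h) y (delta_mx 0 i))%R.

Definition extend S h : E -> \bar R :=
  fun x => if x \in S then h x else +oo.

(* The plain set of minimizers: all of [S] when the objective is identically
   +oo, unlike the convention making it empty in that case. This is what matches
   [fenchel], which is full where [h] is identically +oo. *)
Definition argmin_on S h : set E :=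
  [set x | S x /\ forall z, S z -> h x <= h z].

Definition fenchel S h : E -> set E :=
  fun x => [set u | S x /\
    forall z, S z -> h x + (dot u (z - x))%:E <= h z].

(* [h z - h x] is computed with the inf-addition convention oo - oo = +oo, that
   is, with the dual addition of extended reals. *)
Definition frechet S h : E -> set E :=
  fun x => [set v | S x /\
    0 <= limf_einf
      (fun z => ((h z - h x)%dE - (dot v (z - x))%:E)
                * ((enorm (z - x))^-1)%:E)
      (within S x^')].

Definition limiting S h : E -> set E :=
  fun x => [set v | [/\ S x, h x < +oo &
    exists x_ v_ : nat -> E,
      [/\ forall k, frechet S h (x_ k) (v_ k),
          x_ @ \oo --> x,
          h (x_ k) @[k --> \oo] --> h x &
          v_ @ \oo --> v]]].

Definition one_coercive h : Prop :=
  limf_einf (fun x => h x * ((enorm x)^-1)%:E)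
    (filter_from setT (fun r : R => [set x : E | (r < enorm x)%R])) = +oo.

End ExtendedRealFunctions.

Section Bregman.
Context {R : realType} {n : nat}.
Local Notation E := 'rV[R]_n.
Implicit Types (phi f g : E -> \bar R) (lam : R).
Local Open Scope ereal_scope.

Definition dgf phi : Prop :=
  [/\ proper_on setT phi, lower_semicontinuous phi, convex_ext phi,
      intdom phi !=set0 &
      forall y, intdom phi y -> differentiable (fine \o phi) y].

Definition essentially_smooth phi : Prop :=
  [/\ intdom phi !=set0,
      forall y, intdom phi y -> differentiable (fine \o phi) y &
      forall (x_ : nat -> E) (x : E),
        (forall k, intdom phi (x_ k)) ->
        (closure (dom phi) `\` intdom phi) x ->
        x_ @ \oo --> x ->
        enorm (grad phi (x_ k)) @[k --> \oo] --> +oo%R].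

Definition essentially_strictly_convex phi : Prop :=
  forall C : set E, convex_set C ->
    C `<=` [set x | limiting setT phi x !=set0] ->
    strictly_convex_on C phi.

Definition legendre phi : Prop :=
  essentially_smooth phi /\ essentially_strictly_convex phi.

Definition bregman phi (x y : E) : \bar R :=
  if y \in intdom phi then phi x - phi y - (dot (grad phi y) (x - y))%:E
  else +oo.

Definition left_objective phi lam f (y x : E) : \bar R :=
  f x + (lam^-1)%:E * bregman phi x y.

Definition right_objective phi lam g (x y : E) : \bar R :=
  g y + (lam^-1)%:E * bregman phi x y.

Definition left_prox phi lam f : E -> set E :=
  fun y => [set x | intdom phi y /\
    argmin_on (dom phi) (left_objective phi lam f y) x].

Definition left_env phi lam f : E -> \bar R :=
  fun y => ereal_inf (left_objective phi lam f y @` dom phi).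

Definition right_prox phi lam g : E -> set E :=
  fun x => [set y | dom phi x /\
    argmin_on (intdom phi) (right_objective phi lam g x) y].

Definition right_env phi lam g : E -> \bar R :=
  fun x => ereal_inf (right_objective phi lam g x @` intdom phi).

Definition left_hull phi lam f : E -> \bar R :=
  fun x => - right_env phi lam (fun y => - left_env phi lam f y) x.

Definition left_level phi lam f : E -> set E :=
  fun x => [set u | intdom phi x /\
    forall z, dom phi z ->
      f x + (dot u (z - x))%:E - (lam^-1)%:E * bregman phi z x <= f z].

Definition right_level phi lam g : E -> set E :=
  fun y => [set v | intdom phi y /\
    forall z, intdom phi z ->
      g y + (dot v (grad phi z - grad phi y))%:E
        - (lam^-1)%:E * bregman phi y z <= g z].

End Bregman.

(* Main.v *)
Require Import Defs.
From HB Require Import structures.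
From mathcomp Require Import all_boot all_order all_algebra.
From mathcomp Require Import all_classical all_reals all_analysis.
From mathcomp Require Import ring lra.

Set Implicit Arguments.
Unset Strict Implicit.
Unset Printing Implicit Defensive.

Import Order.TTheory GRing.Theory Num.Theory.
Import numFieldNormedType.Exports.

Local Open Scope classical_set_scope.
Local Open Scope ring_scope.

(** Everything rests on one identity. Let X, Y and Ys be the domain of phi, its
    interior, and the interior of the domain of phis = phi^*. For eta in Ys the
    point y = [grad phis eta] lies in Y, [grad phi y] is eta, and
      D_phi (x, y) = phi x + phis eta - <eta, x>.
    Minimising f + lam^-1 D_phi(., y) over X is therefore maximising
    <eta, .> - (phi + lam f): the left prox at y is the set of points at which
    eta is a Fenchel subgradient of phi + lam f, and lam times the left
    envelope is phis - (phi + lam f)^*, read at eta. Minimising g + lam^-1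
    D_phi(x, .) over Y becomes, in the variable eta, the Fenchel inequality for
    phis + lam (g o grad phis) with slope x. The formulas for the level
    subdifferentials and proximal maps follow by moving finite terms across
    inequalities whose other terms may be infinite, and monotonicity is that of
    Fenchel subdifferentials.

    The identity needs the Legendre bijection between Y and Ys. It comes from
    two facts. Strict convexity makes phi grow linearly above its tangent at
    x in Y ([growth]): hence [grad phi x] is interior to dom phis, and
    maximisers of <eta, .> - phi for eta near [grad phi x] are near x, which
    gives both the gradient of phis and its continuity. Essential smoothness
    confines the points having a subgradient to Y ([fenchel_intdom]), so the
    maximiser, which exists by coercivity, is a preimage of eta under the
    gradient.

    A limiting subdifferential is translated by the gradient of an added C^1
    function ([limiting_sum]). With phis as the added function, the formula for
    the envelope gives the one for the limiting subdifferential of the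
    conjugate of phi + lam f. That the prox is contained in the latter is the
    Fenchel-Young equality. When phi + lam f is lsc and convex, limiting
    subgradients of its conjugate are Fenchel subgradients, and a
    proximal-point argument inverts these ([fenchel_of_conj]).

    The proximal hull lies below f and has the same envelope, so its prox
    contains that of f; and it is convex because D(., y) - D(., y') is affine.
    Conversely a point of the prox of the hull is a Fenchel subgradient at eta
    of the conjugate of F = phi + lam f. For every direction d some maximiser a
    of <eta, .> - F then satisfies <d, a - x> >= 0 ([fenchel_conj_support]:
    compare with the maximisers at eta + s d), and over a compact set of
    maximisers this forces x into the plain convex hull ([conv_of_support], by
    Caratheodory). *)

(** * Euclidean structure and first-order expansions *)

Section Euclidean.
Context {R : realType} {n : nat}.
Local Notation E := 'rV[R]_n.
Implicit Types (u v w x y z d : E) (a b e : R).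

Lemma dotE u v : dot u v = \sum_i u 0 i * v 0 i.
Proof. by rewrite /dot mxE; apply: eq_bigr => i _; rewrite mxE. Qed.

Lemma dotC u v : dot u v = dot v u.
Proof. by rewrite !dotE; apply: eq_bigr => i _; rewrite mulrC. Qed.

Lemma dotDl u v w : dot (u + v) w = dot u w + dot v w.
Proof. by rewrite /dot mulmxDl mxE. Qed.

Lemma dotZl a u v : dot (a *: u) v = a * dot u v.
Proof. by rewrite /dot -scalemxAl mxE. Qed.

Lemma dotDr u v w : dot u (v + w) = dot u v + dot u w.
Proof. by rewrite dotC dotDl !(dotC u). Qed.

Lemma dotZr a u v : dot u (a *: v) = a * dot u v.
Proof. by rewrite dotC dotZl dotC. Qed.

Lemma dotNl u v : dot (- u) v = - dot u v.
Proof. by rewrite -scaleN1r dotZl mulN1r. Qed.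

Lemma dotNr u v : dot u (- v) = - dot u v.
Proof. by rewrite dotC dotNl dotC. Qed.

Lemma dot0l u : dot 0 u = 0.
Proof. by rewrite -(scale0r 0) dotZl mul0r. Qed.

Lemma dot0r u : dot u 0 = 0.
Proof. by rewrite dotC dot0l. Qed.

Definition dotX := (dotDl, dotDr, dotNl, dotNr, dotZl, dotZr, dot0l, dot0r).

Lemma dot_ge0 u : 0 <= dot u u.
Proof. by rewrite dotE sumr_ge0 // => i _; rewrite -expr2 sqr_ge0. Qed.

Lemma dot_eq0 u : dot u u <= 0 -> u = 0.
Proof.
move=> u0; have /eqP : dot u u = 0 by apply/eqP; rewrite eq_le u0 dot_ge0.
rewrite dotE psumr_eq0; last by move=> i _; rewrite -expr2 sqr_ge0.
move=> /allP u00; apply/rowP => i; rewrite mxE; apply/eqP.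
by have := u00 i (mem_index_enum _); rewrite /= mulf_eq0 orbb.
Qed.

Lemma normr_coord u i : `|u 0 i| <= `|u|.
Proof.
rewrite [leRHS]/Num.norm/= mx_normrE.
exact: (le_bigmax _ (fun ij : 'I_1 * 'I_n => `|u ij.1 ij.2|) (0, i)).
Qed.

Lemma norm_le_coord u a : 0 <= a -> (forall i, `|u 0 i| <= a) -> `|u| <= a.
Proof.
move=> a0 ua; rewrite [leLHS]/Num.norm/= mx_normrE; apply/bigmax_leP; split => //.
by move=> [i j] _ /=; rewrite (ord1 i).
Qed.

Lemma dot_le_norm u v : `|dot u v| <= n%:R * `|u| * `|v|.
Proof.
rewrite dotE; apply: le_trans (ler_norm_sum _ _ _) _.
rewrite -mulrA mulr_natl -[X in _ *+ X](card_ord n) -sumr_const.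
by apply: ler_sum => i _; rewrite normrM ler_pM // normr_coord.
Qed.

Lemma enorm_ge0 u : 0 <= enorm u. Proof. exact: sqrtr_ge0. Qed.

Lemma enorm_sqr u : enorm u ^+ 2 = dot u u.
Proof. by rewrite sqr_sqrtr ?dot_ge0. Qed.

Lemma enormZ a u : enorm (a *: u) = `|a| * enorm u.
Proof.
by rewrite /enorm dotZl dotZr mulrA -expr2 sqrtrM ?sqr_ge0 // sqrtr_sqr.
Qed.

Lemma norm_le_enorm u : `|u| <= enorm u.
Proof.
apply: norm_le_coord; first exact: enorm_ge0.
move=> i; rewrite -sqrtr_sqr ler_wsqrtr // dotE (bigD1 i) //= -expr2 lerDl.
by rewrite sumr_ge0 // => j _; rewrite -expr2 sqr_ge0.
Qed.

Lemma enorm0 : enorm (0 : E) = 0.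
Proof. by rewrite /enorm dot0l sqrtr0. Qed.

Lemma enorm_gt0 u : u != 0 -> 0 < enorm u.
Proof. by move=> u0; apply: lt_le_trans (norm_le_enorm u); rewrite normr_gt0. Qed.

Lemma near_dist x e : 0 < e -> \forall z \near x, `|z - x| < e.
Proof.
move=> e0; have := nbhsx_ballx x _ e0; rewrite -ball_normE.
by apply: filterS => z /=; rewrite distrC.
Qed.

Lemma near_distP x (P : set E) : (\forall z \near x, P z) ->
  exists2 e, 0 < e & forall z, `|z - x| < e -> P z.
Proof.
move=> /nbhs_ballP[e /= e0 eP]; exists e => // z ze; apply: eP.
by rewrite -ball_normE /= distrC.
Qed.

Lemma dot_continuous u : continuous (dot u).
Proof.
move=> x; apply/(@cvgrPdist_le R R^o E (nbhs x) _ (dot u) (dot u x)) => e e0.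
have c0 : 0 < n%:R * `|u| + 1 by rewrite ltr_wpDl // mulr_ge0.
near=> y; rewrite -dotNr -dotDr; apply: le_trans (dot_le_norm _ _) _.
have : `|x - y| <= e / (n%:R * `|u| + 1).
  by rewrite distrC ltW //; near: y; apply: near_dist; rewrite divr_gt0.
rewrite ler_pdivlMr // mulrC; apply: le_trans.
by rewrite ler_wpM2r // lerDl.
Unshelve. all: by end_near. Qed.

Lemma dot_is_linear d : linear (dot d).
Proof. by move=> a u v; rewrite dotDr dotZr. Qed.
HB.instance Definition _ d :=
  GRing.isLinear.Build R E R _ (dot d) (dot_is_linear d).

(** The epsilon form of differentiability at x with gradient d; the two lemmas
    below relate it to [differentiable]. *)
Definition has_gradient (F : E -> R) x d := forall e, 0 < e ->
  \forall z \near x, `|F z - F x - dot d (z - x)| <= e * `|z - x|.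

Lemma differentiable_has_gradient (F : E -> R) x : differentiable F x ->
  has_gradient F x (\row_i 'd F x (delta_mx 0 i)).
Proof.
move=> dF e e0; have /diff_locally/eqaddoP/(_ _ e0) := dF.
rewrite [X in X -> _](near_shift x) sub0r; apply: filterS => z /=.
rewrite /shift /= !fctE /= subrK opprD addrA.
suff -> : dot (\row_i 'd F x (delta_mx 0 i)) (z - x) = 'd F x (z - x) by [].
rewrite {2}(row_sum_delta (z - x)) linear_sum dotE; apply: eq_bigr => i _.
by rewrite linearZ mxE mulrC.
Qed.

Lemma has_gradient_differentiable (F : E -> R) x d : has_gradient F x d ->
  differentiable F x /\ (\row_i 'd F x (delta_mx 0 i)) = d.
Proof.
move=> Fd.
have Fo : forall e, 0 < e -> \forall z \near (0 : E),
    `|(F \o shift x \- (cst (F x) + dot d)) z| <= e * `|z|.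
  move=> e e0; have := Fd _ e0.
  rewrite [X in X -> _](near_shift 0) subr0; apply: filterS => z /=.
  by rewrite /shift /= !fctE /= addrK opprD addrA.
have dE : 'd F x = dot d :> (E -> R).
  by apply: (@diff_unique _ _ _ F (dot d)); [exact: dot_continuous|apply/eqaddoP].
split.
  apply/diff_locallyP; rewrite dE; split; first exact: dot_continuous.
  exact/eqaddoP.
apply/rowP => i; rewrite mxE dE dotE (bigD1 i) //= mxE !eqxx mulr1 big1 ?addr0 //.
by move=> j ji; rewrite mxE eqxx (negbTE ji) mulr0.
Qed.

Lemma has_gradient_continuous (F : E -> R) x d : has_gradient F x d ->
  F z @[z --> x] --> F x.
Proof.
by move=> /has_gradient_differentiable[dF _]; exact: differentiable_continuous.
Qed.

Lemma quadratic_continuous a u b x :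
  continuous (fun z : E => a + dot u z + b * dot (z - x) (z - x)).
Proof.
move=> z; apply: (@has_gradient_continuous _ z (u + (2 * b) *: (z - x))) => e e0.
have c0 : 0 < `|b| * n%:R + 1 by rewrite ltr_wpDl // mulr_ge0.
near=> w.
have -> : a + dot u w + b * dot (w - x) (w - x)
    - (a + dot u z + b * dot (z - x) (z - x)) - dot (u + (2 * b) *: (z - x)) (w - z)
    = b * dot (w - z) (w - z).
  by rewrite !dotX !(dotC z) !(dotC w) !(dotC x); ring.
rewrite normrM; apply: le_trans (ler_wpM2l (normr_ge0 b) (dot_le_norm _ _)) _.
rewrite mulrA ler_wpM2r // mulrA.
have : `|w - z| < e / (`|b| * n%:R + 1).
  by near: w; apply: near_dist; rewrite divr_gt0.
rewrite ltr_pdivlMr // mulrC mulrDl mul1r.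
by have := normr_ge0 (w - z); lra.
Unshelve. all: by end_near. Qed.

Lemma affine_continuous a u : continuous (fun z : E => a + dot u z).
Proof.
have -> : (fun z : E => a + dot u z) =
    (fun z => a + dot u z + 0 * dot (z - 0) (z - 0)).
  by apply/funext => z; rewrite mul0r addr0.
exact: quadratic_continuous.
Qed.

End Euclidean.

(** * Fréchet, limiting and Fenchel subdifferentials *)

Section ExtendedInequalities.
Context {R : realType}.
Implicit Types (a b : \bar R) (r s c : R).
Local Open Scope ereal_scope.

Lemma lee_shift a b r s : (a + r%:E <= b + s%:E) = (a + (r - s)%:E <= b).
Proof.
case: a b => [a| |] [b| |]; rewrite ?leey ?leNye //.
by rewrite -!EFinD !lee_fin; apply/idP/idP; lra.
Qed.

Lemma lee_scale_shift c a b r s : (0 < c)%R ->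
  (c%:E * a + r%:E <= c%:E * b + s%:E) = (a + (c^-1 * (r - s))%:E <= b).
Proof.
move=> c0; have c0E : 0 < c%:E by rewrite lte_fin.
case: a b => [a| |] [b| |]; rewrite ?(gt0_muley c0E) ?(gt0_muleNy c0E) ?leey ?leNye //.
rewrite -!EFinM -!EFinD !lee_fin -(ler_pM2l c0 (_ + _)%R b).
have -> : (c * (a + c^-1 * (r - s)) = c * a + (r - s))%R by field; lra.
by apply/idP/idP; lra.
Qed.

(** The convention oo - oo = +oo is what makes this hold at all infinite values;
    it clears the difference quotient in [frechetP]. *)
Lemma lee_dsub a b r : (r%:E <= (a - b)%dE) = (b + r%:E <= a).
Proof.
case: a b => [a| |] [b| |]; rewrite ?leey ?leNye //.
by rewrite -[(_ - _)%dE]/(a - b)%:E -EFinD !lee_fin; apply/idP/idP; lra.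
Qed.

Lemma lee_subr a r s : (r%:E <= a - s%:E) = ((r + s)%:E <= a).
Proof.
case: a => [a| |]; rewrite ?leey ?leNye //.
by rewrite -EFinB !lee_fin; apply/idP/idP; lra.
Qed.

Lemma lee_mulV c a r : (0 < c)%R -> (r%:E <= a * (c^-1)%:E) = ((r * c)%:E <= a).
Proof.
move=> c0; have c0E : 0 < (c^-1)%:E by rewrite lte_fin invr_gt0.
case: a => [a| |]; rewrite ?(gt0_mulye c0E) ?(gt0_mulNye c0E) ?leey ?leNye //.
by rewrite -EFinM !lee_fin ler_pdivlMr.
Qed.

Lemma lee_real_majorants r a : (forall b : R, a <= b%:E -> (r <= b)%R) -> r%:E <= a.
Proof.
case: a => [a| |] ra; first by rewrite lee_fin; exact: ra (lexx _).
  by rewrite leey.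
by have := ra (r - 1)%R (leNye _); rewrite lerBrDr gerDl ler10.
Qed.

Lemma adde_ltNy a b : -oo < a -> -oo < b -> -oo < a + b.
Proof. by case: a b => [a| |] [b| |] //; rewrite -?EFinD ?ltNyr. Qed.

End ExtendedInequalities.

Section Subdifferentials.
Context {R : realType} {n : nat}.
Local Notation E := 'rV[R]_n.
Implicit Types (u v w x y z d : E) (a b c e r s t : R).
Implicit Types (F G h : E -> \bar R) (S T : set E) (q : E -> R) (D : E -> E).

(** Multiplying by the norm removes the quotient. The inequality is trivial at
    z = x, which lets z range over a full neighbourhood, and no difference of
    infinite values is left. *)
Lemma frechetP S h x v : frechet S h x v <->
  S x /\ forall e, 0 < e -> \forall z \near x, S z ->
    (h x + (dot v (z - x) - e * enorm (z - x))%:E <= h z)%E.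
Proof.
rewrite /frechet /= limf_einfE; split => -[Sx hx]; split => //.
  move=> e e0.
  have eN : ((- e)%:E < 0)%E by rewrite lte_fin oppr_lt0.
  have [_ [V SV <-] eV] := ereal_sup_gt (lt_le_trans eN hx).
  move: SV; rewrite /within /= near_withinE => SV.
  move: SV; apply: filterS => z zV Sz.
  have [->|zx] := eqVneq z x.
    by rewrite subrr dot0r enorm0 mulr0 subrr adde0.
  have /ereal_infP/(_ _ (imageP _ (zV zx Sz))) := ltW eV.
  rewrite lee_mulV ?enorm_gt0 ?subr_eq0 // lee_subr lee_dsub.
  by rewrite mulNr [(- _ + _)%R]addrC.
apply/lee_real_majorants => b; apply: contraLR; rewrite -!ltNge => b0.
have e0 : 0 < - b / 2 by lra.
apply: (@lt_le_trans _ _ (b / 2)%:E); first by rewrite lte_fin; lra.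
apply: le_ereal_sup_tmp.
pose V := [set z | [/\ z != x, S z &
  (h x + (dot v (z - x) - (- b / 2) * enorm (z - x))%:E <= h z)%E]].
exists (ereal_inf ((fun z => ((h z - h x)%dE - (dot v (z - x))%:E)
                             * ((enorm (z - x))^-1)%:E)%E @` V)).
  exists V => //.
  rewrite /within /= near_withinE; have := hx _ e0; apply: filterS => z hz zx Sz.
  by split => //; exact: hz.
apply/ereal_infP => _ [z [zx Sz hz] <-].
rewrite lee_mulV ?enorm_gt0 ?subr_eq0 // lee_subr lee_dsub.
by have -> : b / 2 * enorm (z - x) + dot v (z - x)
  = dot v (z - x) - - b / 2 * enorm (z - x) by lra.
Qed.

Lemma fenchel_frechet S h x v : fenchel S h x v -> frechet S h x v.
Proof.
move=> [Sx hx]; apply/frechetP; split => // e e0.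
near=> z => Sz; apply: le_trans (hx _ Sz).
by rewrite leeD2l // lee_fin gerBl mulr_ge0 ?enorm_ge0 // ltW.
Unshelve. all: by end_near. Qed.

Lemma frechet_limiting S h x v : (h x < +oo)%E -> frechet S h x v ->
  limiting S h x v.
Proof.
move=> hx hv; split => //; first by have /frechetP[] := hv.
by exists (fun=> x), (fun=> v); split => //; exact: cvg_cst.
Qed.

Lemma frechet_local S T h x v : (\forall z \near x, T z -> S z) -> T x ->
  frechet S h x v -> frechet T h x v.
Proof.
move=> TS Tx /frechetP[Sx hx]; apply/frechetP; split => // e /hx.
by move: TS; apply: filterS2 => z TS hz /TS.
Qed.

(** Fréchet subgradients are local, so near an interior point of S they do not
    see the domain; of a sequence converging into S only a tail lies in S. *)
Lemma limiting_open S h x v : open S -> S x ->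
  limiting setT h x v <-> limiting S h x v.
Proof.
move=> oS Sx; split => -[_ hx [x_ [v_ [xv xx hxx vv]]]]; split => //.
  have [N _ NS] : \forall k \near \oo, S (x_ k).
    by apply: xx; exact: open_nbhs_nbhs.
  exists (fun k => x_ (k + N)%N), (fun k => v_ (k + N)%N); split.
  - move=> k; apply: frechet_local (xv _); first by near=> z.
    by apply: NS => /=; rewrite leq_addl.
  - by rewrite (cvg_shiftn N x_).
  - by rewrite (cvg_shiftn N (h \o x_)).
  - by rewrite (cvg_shiftn N v_).
exists x_, v_; split => // k; apply: frechet_local (xv k) => //.
have /frechetP[Sxk _] := xv k.
by apply: filterS (open_nbhs_nbhs (conj oS Sxk)).
Unshelve. all: by end_near. Qed.

Lemma has_gradientZ q x d a : has_gradient q x d ->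
  has_gradient (fun z => a * q z) x (a *: d).
Proof.
move=> qd e e0; have a0 : 0 < `|a| + 1 by rewrite ltr_wpDl.
have := qd (e / (`|a| + 1)) (divr_gt0 e0 a0); apply: filterS => z qz.
rewrite dotZl -!mulrBr normrM.
apply: le_trans (ler_wpM2l (normr_ge0 a) qz) _.
rewrite mulrA; apply: ler_wpM2r => //.
by rewrite mulrCA ger_pMr // ler_pdivrMr // mul1r; lra.
Qed.

(** Half of the error allowance goes to F and half to the expansion of q. *)
Lemma frechet_sum S F G q x v d c : 0 < c -> has_gradient q x d ->
  (forall z, S z -> G z = (c%:E * F z + (q z)%:E)%E) ->
  frechet S F x v -> frechet S G x (c *: v + d).
Proof.
move=> c0 qd GF /frechetP[Sx Fx]; apply/frechetP; split => // e e0.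
have e2 : 0 < e / 2 by lra.
have e2c : 0 < e / 2 / c by rewrite divr_gt0.
near=> z => Sz; rewrite GF // GF // -addeA -EFinD lee_scale_shift //.
have Fz : S z -> (F x + (dot v (z - x) - e / 2 / c * enorm (z - x))%:E <= F z)%E.
  by move: Sz => _; near: z; exact: Fx.
apply: le_trans (Fz Sz); rewrite leeD2l // lee_fin ler_pdivrMl // mulrBr.
have -> : c * (e / 2 / c * enorm (z - x)) = e / 2 * enorm (z - x) by field; lra.
have qz : `|q z - q x - dot d (z - x)| <= e / 2 * `|z - x|.
  by near: z; exact: qd.
have := le_trans qz (ler_wpM2l (ltW e2) (norm_le_enorm _)).
by rewrite ler_norml dotDl dotZl => /andP[]; lra.
Unshelve. all: by end_near. Qed.

(** Along x_k -> x the gradients D x_k must converge to D x: this is where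
    continuity of the gradient enters, beyond differentiability. *)
Lemma limiting_sum S F G q D x v c : 0 < c ->
  (forall z, S z -> has_gradient q z (D z)) -> D z @[z --> x] --> D x ->
  (forall z, S z -> G z = (c%:E * F z + (q z)%:E)%E) ->
  limiting S F x v -> limiting S G x (c *: v + D x).
Proof.
move=> c0 qD Dx GF [Sx Fx [x_ [v_ [xv xx Fxx vv]]]].
have Sx_ k : S (x_ k) by have /frechetP[] := xv k.
split => //.
  rewrite GF //; case: (F x) Fx => [r| |] // _; first by rewrite -EFinM -EFinD ltry.
  by rewrite gt0_muleNy ?lte_fin.
exists x_, (fun k => c *: v_ k + D (x_ k)); split => //.
- by move=> k; exact: frechet_sum c0 (qD _ (Sx_ k)) GF (xv k).
- rewrite GF //; under eq_fun do rewrite GF //.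
  apply: cvgeD; first by rewrite fin_num_adde_defl.
    exact: cvgeZl.
  apply: cvg_EFin; first exact: nearW.
  by apply: cvg_comp xx _; exact: has_gradient_continuous (qD _ Sx).
- by apply: cvgD; [apply: cvgZ => //; exact: cvg_cst|exact: cvg_comp xx Dx].
Qed.

Lemma convex_ext_le h x y a b t : convex_ext h ->
  (h x <= a%:E)%E -> (h y <= b%:E)%E -> 0 <= t -> t <= 1 ->
  (h (t *: x + (1 - t) *: y)%R <= (t * a + (1 - t) * b)%:E)%E.
Proof.
move=> ch hx hy t0 t1.
have := ch (x, a) (y, b) (Itv01 t0 t1).
by rewrite !inE /epigraph /= => /(_ hx hy).
Qed.

Lemma convex_set_itv S x y t : convex_set S -> S x -> S y ->
  0 <= t -> t <= 1 -> S (t *: x + (1 - t) *: y).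
Proof.
move=> cS Sx Sy t0 t1; have := cS x y (Itv01 t0 t1).
by rewrite !inE => /(_ Sx Sy).
Qed.

Lemma convex_setI S :
  (forall x y t, S x -> S y -> 0 <= t -> t <= 1 -> S (t *: x + (1 - t) *: y)) ->
  @convex_set R E S.
Proof.
move=> cS x y t; rewrite !inE => Sx Sy.
by apply: (cS x y t%:num).
Qed.

(** The source of the step length in the arguments that let a step tend to 0. *)
Lemma small_step r s : 0 < r -> 0 <= s -> exists2 t, 0 < t <= 1 & t * s < r.
Proof.
move=> r0 s0; exists (r / (r + s + 1)).
  by rewrite divr_gt0 ?ler_pdivrMr /=; lra.
by rewrite mulrAC ltr_pdivrMr; nra.
Qed.

(** Along the segment from x to w convexity bounds the increment of h by a
    linear function of the step, so the first-order inequality at small steps is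
    already the global one. Working with real upper bounds b of h w covers the
    case where h w is -oo. *)
Lemma frechet_fenchel_convex h x v r : convex_ext h -> h x = r%:E ->
  frechet setT h x v -> fenchel setT h x v.
Proof.
move=> ch hx /frechetP[_ hv]; split => // w _.
have hxr : (h x <= r%:E)%E by rewrite hx.
rewrite hx -EFinD; apply: lee_real_majorants => b hw.
rewrite leNgt; apply/negP => bw.
pose N := enorm (w - x); have N0 : 0 <= N by exact: enorm_ge0.
pose g := r + dot v (w - x) - b; have g0 : 0 < g by rewrite /g; lra.
pose e := g / (2 * (N + 1)); have e0 : 0 < e by rewrite divr_gt0 //; lra.
have eN : 2 * (e * N) + 2 * e = g.
  have -> : 2 * (e * N) + 2 * e = e * (2 * (N + 1)) by ring.
  by rewrite divfK // gt_eqF //; lra.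
have [rho rho0 near_x] := near_distP (hv _ e0).
have [s /andP[s0 s1] sN] := small_step rho0 (normr_ge0 (w - x)).
have xz : s *: w + (1 - s) *: x - x = s *: (w - x).
  by rewrite scalerBl scale1r addrCA addrAC subrr add0r scalerBr.
have := near_x (s *: w + (1 - s) *: x).
rewrite xz normrZ gtr0_norm // => /(_ sN I).
rewrite hx dotZr enormZ gtr0_norm // -/N => hz.
have := le_trans hz (convex_ext_le ch hw hxr (ltW s0) s1).
rewrite -EFinD lee_fin => hs.
have : s * (g - e * N) <= 0 by rewrite /g; lra.
by rewrite pmulr_rle0 // => geN; have := mulr_ge0 (ltW e0) N0; lra.
Qed.

Lemma cvg_dot (u_ v_ : nat -> E) u v : u_ @ \oo --> u -> v_ @ \oo --> v ->
  dot (u_ k) (v_ k) @[k --> \oo] --> dot u v.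
Proof.
move=> uu vv; under eq_fun do rewrite dotE.
rewrite dotE.
apply: (@cvg_big R^o _ +%R 0 predT (@add_continuous R^o) _ _ _
  (fun i k => u_ k 0 i * v_ k 0 i) (fun i => u 0 i * v 0 i)) => i _.
apply: cvgM.
  exact: cvg_comp uu (@coord_continuous R 1 n 0 i u).
exact: cvg_comp vv (@coord_continuous R 1 n 0 i v).
Qed.

(** Subgradient inequalities of a convex function are global, hence stable under
    limits of base points, values and slopes. *)
Lemma limiting_fenchel_convex h x v : convex_ext h ->
  (forall z, (-oo < h z)%E) -> limiting setT h x v -> fenchel setT h x v.
Proof.
move=> ch hNy [_ hx [x_ [v_ [xv xx hxx vv]]]]; split => // w _.
move: hx (hNy x) hxx; case: (h x) => [r| |] // _ _.
move=> /fine_cvgP[fin_hx fine_hx].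
rewrite -EFinD; apply: lee_real_majorants => b hw.
have lim_l : fine (h (x_ k)) + dot (v_ k) (w - x_ k) @[k --> \oo]
    --> r + dot v (w - x).
  apply: cvgD; first exact: fine_hx.
  by apply: cvg_dot => //; apply: cvgB => //; exact: cvg_cst.
apply: (cvgr_to_le lim_l); apply: filterS fin_hx => k hk.
have := frechet_fenchel_convex ch (esym (fineK hk)) (xv k).
by move=> [_ /(_ w I) hkw]; rewrite -lee_fin EFinD fineK // (le_trans hkw).
Qed.

End Subdifferentials.

(** * Attainment of minima of lower semicontinuous functions *)

Section LowerSemicontinuity.
Context {R : realType} {n : nat}.
Local Notation E := 'rV[R]_n.
Implicit Types (u v w x y z d : E) (a b c e r s t : R).
Implicit Types (p h : E -> \bar R) (K C : set E) (q : E -> R).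

Lemma real_between (a b : \bar R) : (a < b)%E -> exists2 r : R, (a < r%:E)%E & (r%:E < b)%E.
Proof.
case: a b => [a| |] [b| |] //.
- by rewrite lte_fin => ab; exists ((a + b) / 2); rewrite lte_fin; lra.
- by move=> _; exists (a + 1); rewrite ?ltry // lte_fin; lra.
- by move=> _; exists (b - 1); rewrite ?ltNyr // lte_fin; lra.
- by move=> _; exists 0; rewrite ?ltNyr ?ltry.
Qed.

(** If the infimum m were not attained, the sets {p < b} with b > m would generate
    a filter on K, and lower semicontinuity contradicts p > m at a cluster
    point. *)
Lemma compact_lsc_min p K : lower_semicontinuous p -> compact K -> K !=set0 ->
  exists2 x, K x & forall z, K z -> (p x <= p z)%E.
Proof.
move=> lp cK [x0 Kx0]; pose m := ereal_inf (p @` K).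
apply: contrapT => noMin.
have pm x : K x -> (m < p x)%E.
  move=> Kx; rewrite ltNge; apply/negP => pxm; apply: noMin; exists x => // z Kz.
  by apply: le_trans pxm _; apply: ge_ereal_inf; exists (p z) => //; exists z.
pose B (b : \bar R) := K `&` [set z | (p z < b)%E].
pose F := filter_from [set b | (m < b)%E] B.
have FF : ProperFilter F.
  apply: filter_from_proper; last first.
    by move=> b /ereal_inf_lt[_ [z Kz <-] zb]; exists z.
  apply: filter_from_filter; first by exists (p x0); exact: pm.
  move=> b1 b2 mb1 mb2; exists (Order.min b1 b2); first by rewrite /= lt_min mb1.
  by move=> z [Kz]; rewrite /= lt_min => /andP[].
have FK : F K by exists (p x0); [exact: pm|move=> z []].
have [x [Kx clx]] := cK F FF FK.
have [r mr rp] := real_between (pm _ Kx).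
have [V Vx Vr] := lp _ _ rp.
have [z [[_ zr] Vz]] := clx _ _ (ex_intro2 _ _ r%:E mr (@subset_refl _ _)) Vx.
by have := lt_trans (Vr z Vz) zr; rewrite ltxx.
Qed.

Lemma compact_norm_le r : compact [set z : E | `|z| <= r].
Proof.
apply: bounded_closed_compact.
  exists r; split => [|b rb z /=]; first exact: num_real.
  by move=> zr; exact: le_trans zr (ltW rb).
apply: (@closed_comp _ _ (fun z : E => `|z|) [set s | s <= r]).
  by move=> z _; exact: norm_continuous.
exact: closed_le.
Qed.

Lemma coercive_lsc_min p c b : lower_semicontinuous p -> 0 < c ->
  (forall z, ((c * `|z| - b)%:E <= p z)%E) -> exists x, forall z, (p x <= p z)%E.
Proof.
move=> lp c0 pc.
have [[z0 z0y]|py] := pselect (exists z0, (p z0 < +oo)%E); last first.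
  exists 0 => z; rewrite leNgt; apply/negP => zy; apply: py; exists z.
  exact: lt_le_trans zy (leey _).
have [r pz0] : exists r, p z0 = r%:E.
  by have := pc z0; case: (p z0) z0y => [r| |] //; exists r.
have z0r : `|z0| <= (r + b) / c.
  by rewrite ler_pdivlMr // mulrC; have := pc z0; rewrite pz0 lee_fin; lra.
have [x xr px] := compact_lsc_min lp (@compact_norm_le ((r + b) / c)) (ex_intro _ z0 z0r).
exists x => z; have [/px //|rz] := leP `|z| ((r + b) / c).
apply: le_trans (px _ z0r) _; rewrite pz0; apply: le_trans (pc z).
by rewrite lee_fin; move: rz; rewrite ltr_pdivrMr // mulrC; lra.
Qed.

Lemma lscD p q : lower_semicontinuous p -> continuous q ->
  lower_semicontinuous (fun z => p z + (q z)%:E)%E.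
Proof.
move=> lp cq x a ax.
have ap : ((a - q x)%:E < p x)%E.
  by case: (p x) ax => [r| |]; rewrite ?ltry // -EFinD !lte_fin; lra.
have [b ab bp] := real_between ap.
move: ab; rewrite lte_fin => ab; have e0 : 0 < b - (a - q x) by lra.
have [V Vx Vb] := lp _ _ bp.
have qV : \forall z \near x, q x - (b - (a - q x)) < q z.
  by apply: (cvgr_gt (q x)) (cq x) _ _; rewrite gtrBl.
exists (V `&` [set z | q x - (b - (a - q x)) < q z]); first exact: filterI.
move=> z [/Vb + /=]; case: (p z) => [r| |] //; rewrite ?ltry // -EFinD !lte_fin; lra.
Qed.

Lemma lsc_extend p C : lower_semicontinuous p -> closed C ->
  lower_semicontinuous (extend C p).
Proof.
move=> lp cC x a; rewrite /extend.
have [xC ap|xC _] := boolP (x \in C).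
  have [V Vx Vp] := lp _ _ ap; exists V => // z /Vp; case: ifP => // _ _.
  exact: ltry.
exists (~` C).
  apply: open_nbhs_nbhs; split; first exact: closed_openC.
  by move: xC; rewrite notin_setE.
by move=> z /= zC; rewrite memNset // ltry.
Qed.

Lemma lsc_closed_le p a : lower_semicontinuous p ->
  closed [set z | (p z <= a%:E)%E].
Proof.
move=> /lower_semicontinuousP/(_ a)/open_closedC.
suff -> : [set z | (p z <= a%:E)%E] = ~` [set z | (a%:E < p z)%E] by [].
by apply/seteqP; split => z /=; rewrite leNgt => /negP.
Qed.

(** Outside a ball this is the definition of coercivity; on the ball p is bounded
    below because it attains its minimum. *)
Lemma one_coercive_growth p c : lower_semicontinuous p ->
  (forall z, (-oo < p z)%E) -> one_coercive p ->
  exists b, forall z, ((c * enorm z - b)%:E <= p z)%E.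
Proof.
move=> lp pNy; rewrite /one_coercive limf_einfE => pc.
have cy : (c%:E < +oo)%E by rewrite ltry.
rewrite -pc in cy; have [_ [V [r _ rV] <-] cV] := ereal_sup_gt cy.
pose rho := Num.max r 0.
have rho0 : 0 <= rho by rewrite le_max lexx orbT.
have K0 : [set z : E | `|z| <= rho] !=set0 by exists 0; rewrite /= normr0.
have [x _ px] := compact_lsc_min lp (@compact_norm_le rho) K0.
have [m mx] : exists m, (m%:E <= p x)%E.
  case: (p x) (pNy x) => [m| |] // _; first by exists m.
  by exists 0; rewrite leey.
exists (`|c| * rho + `|m|) => z.
have cz : c * enorm z <= `|c| * enorm z.
  by rewrite ler_wpM2r ?enorm_ge0 // ler_norm.
have [zr|rz] := leP (enorm z) rho.
  apply: le_trans (px z _); last exact: le_trans (norm_le_enorm z) zr.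
  apply: le_trans mx; rewrite lee_fin.
  have := ler_wpM2l (normr_ge0 c) zr; have := ler_norm (- m); rewrite normrN.
  lra.
have [rz' z0] : r < enorm z /\ 0 < enorm z.
  by move: rz; rewrite gt_max => /andP[].
have /ereal_infP/(_ _ (imageP _ (rV z rz'))) := ltW cV.
rewrite lee_mulV //; apply: le_trans; rewrite lee_fin gerBl.
by rewrite addr_ge0 // mulr_ge0.
Qed.

End LowerSemicontinuity.

(** * Conjugates *)

Section Conjugation.
Context {R : realType} {n : nat}.
Local Notation E := 'rV[R]_n.
Implicit Types (u v w x y z eta zeta d : E) (a b c e r s t : R).
Implicit Types (p h : E -> \bar R).

Lemma conj_le h u b :
  (conj_fun h u <= b%:E)%E <-> forall z, ((dot u z - b)%:E <= h z)%E.
Proof.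
have hz z : ((dot u z)%:E - h z <= b%:E)%E = ((dot u z - b)%:E <= h z)%E.
  case: (h z) => [r| |]; rewrite ?leey ?leNye //.
  by rewrite -EFinB !lee_fin; apply/idP/idP; lra.
split=> [/ereal_supP hb z|hb]; first by rewrite -hz; apply: hb; exists z.
by apply/ereal_supP => _ [z _ <-]; rewrite hz.
Qed.

Lemma conj_ge h u z : ((dot u z)%:E - h z <= conj_fun h u)%E.
Proof. by apply: le_ereal_sup_tmp; exists ((dot u z)%:E - h z)%E => //; exists z. Qed.

Lemma conj_ge_fin h u z r : h z = r%:E -> ((dot u z - r)%:E <= conj_fun h u)%E.
Proof. by move=> hz; rewrite EFinB -hz; exact: conj_ge. Qed.

Lemma conj_gtNy h u z : (h z < +oo)%E -> (-oo < conj_fun h u)%E.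
Proof.
move=> hz; apply: lt_le_trans (conj_ge h u z).
by case: (h z) hz => [r| |] // _; rewrite -?EFinB ?ltNyr.
Qed.

(** The equality case of the Fenchel-Young inequality. It covers h identically
    +oo, where both sides are -oo. *)
Lemma conj_attained h u x : fenchel setT h x u ->
  conj_fun h u = ((dot u x)%:E - h x)%E.
Proof.
move=> [_ hu]; apply/eqP; rewrite eq_le conj_ge andbT.
apply/ereal_supP => _ [z _ <-]; have := hu z I.
case: (h x) (h z) => [a| |] [b| |] //=; rewrite ?leey ?leNye //.
by rewrite -EFinD -!EFinB !lee_fin dotDr dotNr; lra.
Qed.

Lemma fenchel_conj h x u : fenchel setT h x u -> fenchel setT (conj_fun h) u x.
Proof.
move=> hu; split => // v _; rewrite (conj_attained hu).
apply: le_trans (conj_ge h v x).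
case: (h x) => [a| |]; rewrite ?leey ?leNye //.
by rewrite -EFinB -EFinD -EFinB lee_fin dotDr dotNr !(dotC x); lra.
Qed.

Lemma convex_extI h :
  (forall x y a b t, (h x <= a%:E)%E -> (h y <= b%:E)%E -> 0 <= t -> t <= 1 ->
     (h (t *: x + (1 - t) *: y)%R <= (t * a + (1 - t) * b)%:E)%E) ->
  convex_ext h.
Proof.
move=> ch [x a] [y b] t; rewrite !inE /epigraph /= => hx hy.
exact: (ch x y a b t%:num).
Qed.

Lemma convex_conj h : convex_ext (conj_fun h).
Proof.
apply: convex_extI => u v a b t /conj_le ua /conj_le vb t0 t1.
apply/conj_le => z; apply: lee_real_majorants => r zr.
have := ua z; have := vb z => /le_trans/(_ zr) + /le_trans/(_ zr).
rewrite !lee_fin => vz uz.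
have t1' : 0 <= 1 - t by lra.
have := lerD (ler_wpM2l t0 uz) (ler_wpM2l t1' vz).
by rewrite dotDl !dotZl; lra.
Qed.

(** A proximal-point argument. The tilted function p = h - <u, .> + c is
    nonnegative, so p + |. - x|^2 / 2 has a minimiser z, and u + (x - z) is a
    subgradient of h at z. Testing the hypothesis at this slope gives
    p z + |x - z|^2 <= 0: hence z = x and p x = 0, which is the Fenchel-Young equality. *)
Lemma fenchel_of_conj h x u c : lower_semicontinuous h -> convex_ext h ->
  proper_on setT h -> conj_fun h u = c%:E ->
  fenchel setT (conj_fun h) u x -> fenchel setT h x u.
Proof.
move=> lh ch [hNy [z0 _ z0y]] cE [_ fu].
have hc z : ((dot u z - c)%:E <= h z)%E by move: z; apply/conj_le; rewrite cE.
(* h + q is p + |. - x|^2 / 2 for the nonnegative tilt p of h. *)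
pose q z : R := c + dot (- u) z + 2^-1 * dot (z - x) (z - x).
have cq : continuous q by exact: quadratic_continuous.
have qh z : ((1 * `|z| - (`|x| + 1))%:E <= h z + (q z)%:E)%E.
  have : ((dot u z - c + q z)%:E <= h z + (q z)%:E)%E by rewrite EFinD leeD2r.
  apply: le_trans; rewrite lee_fin /q dotNl.
  have := norm_le_enorm (z - x); have := enorm_sqr (z - x).
  have := ler_normD (z - x) x; rewrite subrK.
  set N := enorm _; have := sqr_ge0 (N - 1); rewrite sqrrB; lra.
have [z zmin] := coercive_lsc_min (lscD lh cq) ltr01 qh.
have hz : exists r, h z = r%:E.
  have := zmin z0; case: (h z) (hNy z I) => [r| |] // _; first by exists r.
  by rewrite leye_eq; case: (h z0) z0y.
have {hz}[r hz] := hz.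
have sub w : (r%:E + (dot (u + (x - z)) (w - z))%:E <= h w)%E.
  rewrite -EFinD; apply: lee_real_majorants => b hw.
  rewrite leNgt; apply/negP => bw.
  have g0 : 0 < r + dot (u + (x - z)) (w - z) - b by lra.
  have [s /andP[s0 s1] sK] := small_step g0 (dot_ge0 (w - z)).
  have hzr : (h z <= r%:E)%E by rewrite hz.
  have := zmin (s *: w + (1 - s) *: z); rewrite hz.
  move=> /le_trans/(_ (leeD2r _ (convex_ext_le ch hw hzr (ltW s0) s1))).
  rewrite -!EFinD lee_fin /q !dotNl => hs.
  have : s * (r + dot (u + (x - z)) (w - z) - b) <= s * (2^-1 * s * dot (w - z) (w - z)).
    move: hs; rewrite !dotX !(dotC z) !(dotC w) !(dotC x).
    set k := dot w w; clear; lra.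
  rewrite ler_pM2l // => hg; have := mulr_ge0 (ltW s0) (dot_ge0 (w - z)); lra.
have cz : conj_fun h (u + (x - z)) = (dot (u + (x - z)) z - r)%:E.
  by rewrite (@conj_attained _ _ z) ?hz ?EFinB //; split => // w _; rewrite hz.
have := fu (u + (x - z)) I.
rewrite cE cz -EFinD lee_fin => cxz.
have := hc z; rewrite hz lee_fin => hcz.
have xz : x - z = 0.
  apply: dot_eq0; move: cxz; rewrite !dotX !(dotC z) !(dotC x).
  by lra.
have {}xz : x = z by apply/eqP; rewrite -subr_eq0 xz.
split => // w _; rewrite xz hz.
apply: le_trans (hc w); rewrite -EFinD lee_fin.
by move: cxz; rewrite xz subrr addr0 !dotX; lra.
Qed.

End Conjugation.

(** * Gradients of a distance-generating function *)

Section DistanceGeneratingFunctions.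
Context {R : realType} {n : nat}.
Local Notation E := 'rV[R]_n.
Implicit Types (u v w x y z eta zeta d : E) (a b c e r s t : R).
Context {phi : E -> \bar R}.
Context (phi_dgf : dgf phi).

Let phi_proper : proper_on setT phi. Proof. by case: phi_dgf. Qed.
Let phi_lsc : lower_semicontinuous phi. Proof. by case: phi_dgf. Qed.
Let phi_convex : convex_ext phi. Proof. by case: phi_dgf. Qed.
Let phi_gtNy x : (-oo < phi x)%E. Proof. by case: phi_proper => + _; apply. Qed.

Lemma dom_fin x : dom phi x -> phi x = (fine (phi x))%:E.
Proof.
by rewrite /dom /= => xy; rewrite fineK // fin_numE -ltNye phi_gtNy -ltey.
Qed.

Lemma dom_intdom y : intdom phi y -> dom phi y.
Proof. exact: interior_subset. Qed.

Lemma intdom_ball y : intdom phi y ->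
  exists2 r, 0 < r & forall z, `|z - y| < r -> intdom phi z.
Proof.
move=> yY; apply: near_distP; apply: open_nbhs_nbhs.
by split => //; exact: open_interior.
Qed.

Lemma grad_has_gradient y : intdom phi y ->
  has_gradient (fine \o phi) y (grad phi y).
Proof. by case: phi_dgf => _ _ _ _ + yY; move=> /(_ y yY)/differentiable_has_gradient. Qed.

(** The expansion of phi at y makes the gradient a Fréchet subgradient, and
    convexity makes that global. *)
Lemma grad_fenchel y : intdom phi y -> fenchel setT phi y (grad phi y).
Proof.
move=> yY; apply: frechet_fenchel_convex (dom_fin (dom_intdom yY)) _ => //.
apply/frechetP; split => // e e0; have := grad_has_gradient yY e0.
apply: filterS => z /= hz _.
have [zy|zy] := pselect (dom phi z); last first.
  by move: zy; rewrite /dom /= ltey => /negP; rewrite negbK => /eqP ->; rewrite leey.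
rewrite (dom_fin (dom_intdom yY)) (dom_fin zy) -EFinD lee_fin.
have := le_trans hz (ler_wpM2l (ltW e0) (norm_le_enorm _)).
by rewrite ler_norml => /andP[+ _]; lra.
Qed.

Lemma grad_le y z r : intdom phi y -> phi z = r%:E ->
  fine (phi y) + dot (grad phi y) (z - y) <= r.
Proof.
move=> yY zr; have [_ /(_ z I)] := grad_fenchel yY.
by rewrite zr (dom_fin (dom_intdom yY)) -EFinD lee_fin.
Qed.

(** A small step in the direction u - grad phi y would beat the first-order
    expansion of phi. *)
Lemma fenchel_grad y u : intdom phi y -> fenchel setT phi y u -> u = grad phi y.
Proof.
move=> yY [_ hu]; apply/eqP; rewrite -subr_eq0; apply/eqP/dot_eq0.
set d := u - grad phi y; rewrite leNgt; apply/negP => d0.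
pose e := dot d d / (2 * (`|d| + 1)); have e0 : 0 < e.
  by rewrite divr_gt0 // mulr_gt0 // ltr_wpDl.
have [r r0 hr] := near_distP (grad_has_gradient yY e0).
have [r' r'0 hr'] := intdom_ball yY.
have rr : 0 < Num.min r r' by rewrite lt_min r0.
have [s /andP[s0 s1] sd] := small_step rr (normr_ge0 d).
have zy : `|y + s *: d - y| < Num.min r r'.
  by rewrite addrAC subrr add0r normrZ gtr0_norm.
move: (zy); rewrite lt_min => /andP[/hr /= + /hr'/dom_intdom/dom_fin zfin].
have := hu (y + s *: d) I; rewrite zfin (dom_fin (dom_intdom yY)) -EFinD lee_fin.
rewrite addrAC subrr add0r normrZ gtr0_norm // ler_norml !dotZr => uz /andP[_ gz].
have : s * dot d d <= s * (e * `|d|).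
  by rewrite {1}/d dotDl dotNl; lra.
rewrite ler_pM2l // => dd.
have : e * (2 * (`|d| + 1)) = dot d d.
  by rewrite divfK // gt_eqF // mulr_gt0 // ltr_wpDl.
by have := normr_ge0 d; lra.
Qed.

Lemma dom_convex x y t : dom phi x -> dom phi y -> 0 <= t -> t <= 1 ->
  dom phi (t *: x + (1 - t) *: y).
Proof.
move=> /dom_fin xf /dom_fin yf t0 t1; rewrite /dom /=.
have xx : (phi x <= (fine (phi x))%:E)%E by rewrite -xf.
have yy : (phi y <= (fine (phi y))%:E)%E by rewrite -yf.
exact: le_lt_trans (convex_ext_le phi_convex xx yy t0 t1) (ltry _).
Qed.

(** The ball around y contracts towards x onto a ball inside dom phi. *)
Lemma intdom_segment x y t : dom phi x -> intdom phi y -> 0 < t -> t <= 1 ->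
  intdom phi (t *: y + (1 - t) *: x).
Proof.
move=> xX yY t0 t1; have [r r0 hr] := intdom_ball yY.
have tr : 0 < t * r by rewrite mulr_gt0.
have := near_dist (t *: y + (1 - t) *: x) tr; apply: filterS => z zt.
pose w := y + t^-1 *: (z - (t *: y + (1 - t) *: x)).
have -> : z = t *: w + (1 - t) *: x.
  rewrite /w scalerDr scalerA divff ?gt_eqF // scale1r.
  by rewrite addrAC addrC subrK.
apply: dom_convex => //; last exact: ltW.
apply/dom_intdom/hr; rewrite /w addrAC subrr add0r normrZ gtr0_norm ?invr_gt0 //.
by rewrite mulrC ltr_pdivrMr // mulrC.
Qed.




End DistanceGeneratingFunctions.

(** * Essential smoothness *)

Section LegendreDuality.
Context {R : realType} {n : nat}.
Local Notation E := 'rV[R]_n.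
Implicit Types (u v w x y z eta zeta d : E) (a b c e r s t : R).
Context {phi : E -> \bar R} (phi_dgf : dgf phi).

Let phi_proper : proper_on setT phi. Proof. by case: phi_dgf. Qed.
Let phi_lsc : lower_semicontinuous phi. Proof. by case: phi_dgf. Qed.
Let phi_convex : convex_ext phi. Proof. by case: phi_dgf. Qed.
Let phi_gtNy x : (-oo < phi x)%E. Proof. by case: phi_proper => + _; apply. Qed.

Local Notation phis := (conj_fun phi).

Lemma fenchel_dom x u : fenchel setT phi x u -> dom phi x.
Proof.
have [_ [z0 _ z0y]] := phi_proper; move=> [_ /(_ z0 I)]; rewrite /dom /=.
by case: (phi x) (phi_gtNy x) z0y => [r| |] //; rewrite ?ltry //; case: (phi z0).
Qed.

Lemma grad_bounded_above y : intdom phi y ->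
  exists r M, 0 < r /\ forall z, `|z - y| <= r -> dom phi z /\ fine (phi z) <= M.
Proof.
move=> yY; have [r r0 hr] := intdom_ball yY.
have [s s0 hs] := near_distP (grad_has_gradient phi_dgf yY ltr01).
pose rho := Num.min r s / 2.
have rs0 : 0 < Num.min r s by rewrite lt_min r0.
exists rho, (fine (phi y) + (n%:R * `|grad phi y| + 1) * rho); split.
  by rewrite divr_gt0.
move=> z zy; have : `|z - y| < Num.min r s by rewrite (le_lt_trans zy) // /rho; lra.
rewrite lt_min => /andP[/hr/dom_intdom zX /hs /= h4]; split => //.
move: (ler_norm (dot (grad phi y) (z - y))) (dot_le_norm (grad phi y) (z - y)).
have c0 : 0 <= n%:R * `|grad phi y| + 1 by rewrite addr_ge0 ?mulr_ge0.
have := ler_wpM2l c0 zy; rewrite !mulrDl !mul1r => h1 h2 h3.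
by move: h4; rewrite ler_norml mul1r => /andP[_ h4]; lra.
Qed.

(** Suppose x is a boundary point with a subgradient u, and take y interior. At
    points x_k of the segment from x to y, monotonicity keeps
    <grad phi x_k, y - x> above <u, y - x>. Testing the gradient inequality at
    y + r G / |G|, where G is the gradient at x_k and phi is bounded near y,
    then bounds |G|, whereas essential smoothness makes it blow up. *)
Lemma fenchel_intdom x u : essentially_smooth phi ->
  fenchel setT phi x u -> intdom phi x.
Proof.
move=> [[y yY] _ blowup] xu; have xX := fenchel_dom xu.
apply: contrapT => xNY.
have [r [M [r0 hM]]] := grad_bounded_above yY.
pose t k : R := (k.+1%:R)^-1.
have t0 k : 0 < t k by rewrite invr_gt0.
have t1 k : t k <= 1 by rewrite invf_le1 // ler1n.
pose x_ k := t k *: y + (1 - t k) *: x.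
have xY k : intdom phi (x_ k) by exact: intdom_segment.
have xx : x_ @ \oo --> x.
  have -> : x_ = fun k => x + t k *: (y - x).
    by apply/funext => k; rewrite /x_ scalerBl scale1r scalerBr addrCA.
  rewrite -[X in _ --> X]addr0 -(scale0r (y - x)).
  apply: cvgD; first exact: cvg_cst.
  by apply: cvgZ; [exact: cvg_harmonic|exact: cvg_cst].
have clx : (closure (dom phi) `\` intdom phi) x.
  by split => //; exact: subset_closure.
have := blowup x_ x xY clx xx.
(* B / r will bound |G|; the two copies of |<u, y - x>| absorb the terms
   t_k <u, y - x> and (1 - t_k) <u, y - x>. *)
pose B := M - fine (phi x) + 2 * `|dot u (y - x)|.
move=> /cvgryPgt/(_ (Num.max (B / r) 0))[k _ /(_ _ (leqnn k))] /=.
rewrite gt_max => /andP[+ N0]; apply/negP; rewrite -leNgt ler_pdivlMr // mulrC.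
set G := grad phi (x_ k) in N0 *; set N := enorm G in N0 *.
have [_ hu] := xu.
have xkfin := dom_fin phi_dgf (dom_intdom (xY k)).
have := hu (x_ k) I; rewrite xkfin (dom_fin phi_dgf xX) -EFinD lee_fin => h1.
have h2 := grad_le phi_dgf (xY k) (dom_fin phi_dgf xX).
pose z := y + (r / N) *: G.
have zy : `|z - y| <= r.
  rewrite /z addrAC subrr add0r normrZ gtr0_norm ?divr_gt0 //.
  rewrite mulrAC ler_pdivrMr // ler_pM2l //; exact: norm_le_enorm.
have [zX zM] := hM _ zy.
have h3 := grad_le phi_dgf (xY k) (dom_fin phi_dgf zX).
move: h1 h2 h3; rewrite -/G.
have -> : x_ k - x = t k *: (y - x) by apply/rowP => i; rewrite !mxE; ring.
have -> : x - x_ k = - t k *: (y - x) by apply/rowP => i; rewrite !mxE; ring.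
have -> : z - x_ k = (r / N) *: G + (1 - t k) *: (y - x).
  by apply/rowP => i; rewrite !mxE; ring.
rewrite !(dotDr, dotZr) -enorm_sqr -/N.
have -> : r / N * N ^+ 2 = r * N by field; rewrite gt_eqF.
set p := dot u (y - x); set q := dot G (y - x) => h1 h2 h3.
have qp : p <= q.
  by rewrite -(ler_pM2l (t0 k)); lra.
have tq : (1 - t k) * p <= (1 - t k) * q.
  by rewrite ler_wpM2l // subr_ge0.
have tp : `|t k * p| <= `|p|.
  by rewrite normrM gtr0_norm // ler_piMl.
move: tp; rewrite ler_norml => /andP[tp _].
have : `|(1 - t k) * p| <= `|p|.
  by rewrite normrM ger0_norm ?subr_ge0 // ler_piMl // gerBl ltW.
by rewrite ler_norml /B -/p => /andP[tp' _]; lra.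
Qed.

End LegendreDuality.

(** * Strict convexity and growth *)

Section LegendreGradients.
Context {R : realType} {n : nat}.
Local Notation E := 'rV[R]_n.
Implicit Types (u v w x y z eta zeta d : E) (a b c e r s t : R).
Context {phi : E -> \bar R} (phi_dgf : dgf phi) (phi_leg : legendre phi).

Let phi_proper : proper_on setT phi. Proof. by case: phi_dgf. Qed.
Let phi_lsc : lower_semicontinuous phi. Proof. by case: phi_dgf. Qed.
Let phi_convex : convex_ext phi. Proof. by case: phi_dgf. Qed.
Let phi_gtNy x : (-oo < phi x)%E. Proof. by case: phi_proper => + _; apply. Qed.

Local Notation phis := (conj_fun phi).

(** Strict convexity is applied on a ball inside int dom phi, all of whose points
    carry a subgradient, namely the gradient; the midpoint of w and x does the
    rest. *)
Lemma strict_gradient_ineq x r w : intdom phi x ->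
  (forall z, `|z - x| < r -> intdom phi z) -> `|w - x| < r -> w <> x ->
  fine (phi x) + dot (grad phi x) (w - x) < fine (phi w).
Proof.
move=> xY rY wr wx; have [_ strict] := phi_leg.
have ballC : @convex_set R E [set z | `|z - x| < r].
  apply: convex_setI => z1 z2 t /= z1r z2r t0 t1.
  have -> : t *: z1 + (1 - t) *: z2 - x = t *: (z1 - x) + (1 - t) *: (z2 - x).
    by apply/rowP => i; rewrite !mxE; ring.
  apply: le_lt_trans (ler_normD _ _) _.
  rewrite !normrZ (ger0_norm t0) ger0_norm ?subr_ge0 //.
  have [->|t0'] := eqVneq t 0; first by rewrite mul0r add0r subr0 mul1r.
  have tp : 0 < t by rewrite lt_neqAle eq_sym t0'.
  have h1 : t * `|z1 - x| < t * r by rewrite ltr_pM2l.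
  have h2 : (1 - t) * `|z2 - x| <= (1 - t) * r by rewrite ler_wpM2l ?subr_ge0 // ltW.
  lra.
have ballL : [set z | `|z - x| < r] `<=` [set z | limiting setT phi z !=set0].
  move=> z /rY zY; exists (grad phi z); apply: frechet_limiting.
    exact: dom_intdom zY.
  exact/fenchel_frechet/grad_fenchel.
have xr : `|x - x| < r by rewrite subrr normr0 (le_lt_trans _ wr).
have h2 : (0 < (2^-1 : R)) && ((2^-1 : R) < 1) by lra.
have := strict _ ballC ballL w x 2^-1 wr xr wx h2.
have -> : 1 - 2^-1 = 2^-1 :> R by field.
have mY : intdom phi (2^-1 *: w + 2^-1 *: x).
  apply: rY; have -> : 2^-1 *: w + 2^-1 *: x - x = 2^-1 *: (w - x).
    by apply/rowP => i; rewrite !mxE; field.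
  rewrite normrZ gtr0_norm; last by lra.
  by have := normr_ge0 (w - x); lra.
have wX := dom_intdom (rY w wr).
have := grad_le phi_dgf xY (dom_fin phi_dgf (dom_intdom mY)).
rewrite (dom_fin phi_dgf wX) (dom_fin phi_dgf (dom_intdom xY)).
rewrite (dom_fin phi_dgf (dom_intdom mY)) -!EFinM -EFinD lte_fin /=.
have -> : 2^-1 *: w + 2^-1 *: x - x = 2^-1 *: (w - x).
  by apply/rowP => i; rewrite !mxE; field.
by rewrite dotZr; lra.
Qed.

Lemma subr_continuous_cst x : continuous (fun z : E => z - x).
Proof.
move=> z; apply: (@cvgB R E E (nbhs z) _ idfun (cst x) z x).
  exact: cvg_id.
exact: cvg_cst.
Qed.

(** On a small sphere around x the gap between phi and its tangent is positive
    and lower semicontinuous, hence bounded below by some m > 0; convexity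
    propagates this outwards linearly along rays. *)
Lemma growth x r : intdom phi x -> 0 < r -> exists2 c, 0 < c &
  forall z, r <= `|z - x| ->
    (phi x + (dot (grad phi x) (z - x) + c * `|z - x|)%:E <= phi z)%E.
Proof.
move=> xY r0; have [r1 r10 r1Y] := intdom_ball xY.
(* The radius of the sphere: at most r, and small enough to stay in
   int dom phi. *)
pose rho := Num.min r (r1 / 2).
have rho0 : 0 < rho by rewrite lt_min r0 divr_gt0.
have rhor : rho <= r by rewrite ge_min lexx.
have rhor1 : rho < r1.
  by apply: (@le_lt_trans _ _ (r1 / 2)); [rewrite ge_min lexx orbT|lra].
pose K := [set z : E | `|z - x| = rho].
have scale z s : s *: z + (1 - s) *: x - x = s *: (z - x).
  by apply/rowP => i; rewrite !mxE; ring.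
have toK z : r <= `|z - x| ->
    K ((rho / `|z - x|) *: z + (1 - rho / `|z - x|) *: x).
  move=> rz; have z0 : 0 < `|z - x| by apply: lt_le_trans rz.
  by rewrite /K /= scale normrZ gtr0_norm ?divr_gt0 // divfK // gt_eqF.
have [K0|K0] := pselect (K !=set0); last first.
  by exists 1 => // z /toK zK; case: K0; eexists; exact: zK.
have cK : compact K.
  apply: (subclosed_compact _ (@compact_norm_le R n (rho + `|x|))).
    apply: (@closed_comp _ _ (fun z : E => `|z - x|) [set s | s = rho]).
      move=> z _; apply: (@continuous_comp _ _ _ (fun z => z - x) (fun z : E => `|z|)).
        exact: subr_continuous_cst.
      exact: norm_continuous.
    exact: closed_eq.
  move=> z /= zx; rewrite -[z](subrK x); apply: le_trans (ler_normD _ _) _.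
  by rewrite zx.
have lq : lower_semicontinuous (fun z => phi z +
    (dot (grad phi x) x - fine (phi x) + dot (- grad phi x) z)%:E)%E.
  by apply: lscD => //; exact: affine_continuous.
have [w0 Kw0 w0min] := compact_lsc_min lq cK K0.
have KY w : K w -> dom phi w by move=> Kw; apply/dom_intdom/r1Y; rewrite Kw.
pose m := fine (phi w0) - fine (phi x) - dot (grad phi x) (w0 - x).
have m0 : 0 < m.
  rewrite /m; have := @strict_gradient_ineq x r1 w0 xY r1Y.
  rewrite Kw0 => /(_ rhor1); rewrite -subr_gt0 opprD addrA; apply.
  by move=> w0x; move: Kw0 rho0; rewrite /K /= w0x subrr normr0 => <-; rewrite ltxx.
have {}w0min w : K w -> m <= fine (phi w) - fine (phi x) - dot (grad phi x) (w - x).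
  move=> Kw; have := w0min w Kw.
  rewrite (dom_fin phi_dgf (KY _ Kw)) (dom_fin phi_dgf (KY _ Kw0)).
  rewrite -!EFinD lee_fin !dotNl /m !dotDr !dotNr.
  lra.
exists (m / rho); first by rewrite divr_gt0.
move=> z rz; have z0 : 0 < `|z - x| by apply: lt_le_trans rz.
rewrite (dom_fin phi_dgf (dom_intdom xY)) -EFinD.
apply: lee_real_majorants => b zb.
have xb : (phi x <= (fine (phi x))%:E)%E by rewrite -dom_fin //; exact: dom_intdom.
pose s := rho / `|z - x|; have s0 : 0 < s by rewrite divr_gt0.
have s1 : s <= 1 by rewrite ler_pdivrMr // mul1r; lra.
have Kw := toK _ rz; rewrite -/s in Kw.
have := convex_ext_le phi_convex zb xb (ltW s0) s1.
rewrite (dom_fin phi_dgf (KY _ Kw)) lee_fin => hw.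
have := w0min _ Kw; rewrite scale dotZr => hm.
rewrite -(ler_pM2l s0).
have -> : s * (fine (phi x) + (dot (grad phi x) (z - x) + m / rho * `|z - x|))
   = s * fine (phi x) + s * dot (grad phi x) (z - x) + m.
  by rewrite /s; field; rewrite !gt_eqF.
lra.
Qed.

(** A perturbation of the slope smaller than the growth constant keeps
    <eta, .> - phi bounded above. *)
Lemma grad_intdom_conj x : intdom phi x -> intdom phis (grad phi x).
Proof.
move=> xY; have [c c0 hc] := growth xY ltr01.
have cn : 0 < c / (n%:R + 1) by rewrite divr_gt0 // ltr_wpDl.
have := near_dist (grad phi x) cn; apply: filterS => eta.
rewrite ltr_pdivlMr ?ltr_wpDl // => etac.
have xfin := dom_fin phi_dgf (dom_intdom xY).
rewrite /dom /=.
apply: (@le_lt_trans _ _ (c + dot eta x - fine (phi x))%:E); last exact: ltry.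
apply/conj_le => z.
have := dot_le_norm (eta - grad phi x) (z - x); rewrite ler_norml => /andP[_].
have h : n%:R * `|eta - grad phi x| * `|z - x| <= c * `|z - x|.
  rewrite ler_wpM2r //; have := normr_ge0 (eta - grad phi x); lra.
rewrite !dotX => hz.
have [z1|z1] := leP 1 `|z - x|.
  apply: le_trans (hc z z1); rewrite xfin -EFinD lee_fin !dotX; lra.
have [_ /(_ z I)] := grad_fenchel phi_dgf xY; apply: le_trans.
rewrite xfin -EFinD lee_fin !dotX.
have : c * `|z - x| <= c * 1 by rewrite ler_wpM2l // ltW.
lra.
Qed.

(** Finiteness of the conjugate at the 2n points eta +- r e_i makes phi - <eta, .>
    grow like r |z|, so it attains its minimum. *)
Lemma conj_intdom_attained eta : intdom phis eta ->
  exists x, fenchel setT phi x eta.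
Proof.
move=> etaY; have [rho rho0 hrho] := intdom_ball etaY.
have fin_near zeta : `|zeta - eta| < rho -> exists M, forall z,
    ((dot zeta z - M)%:E <= phi z)%E.
  move=> /hrho/dom_intdom; rewrite /dom /= => zy.
  have [z0 _ z0y] : exists2 x, [set: E] x & (phi x < +oo)%E by case: phi_proper.
  have := conj_gtNy zeta z0y.
  case E : (conj_fun phi zeta) zy => [M| |] // _ _.
  by exists M; apply/conj_le; rewrite E.
pose r := rho / 2; have r0 : 0 < r by rewrite divr_gt0.
have near_e i s : `|s| <= 1 -> `|eta + (s * r) *: delta_mx 0 i - eta| < rho.
  move=> s1; rewrite addrAC subrr add0r normrZ normrM (gtr0_norm r0).
  have d1 : `|delta_mx 0 i : E| <= 1.
    apply: norm_le_coord => // j; rewrite mxE.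
    by case: (_ && _); rewrite ?normr1 ?normr0.
  have : `|s| * r * `|delta_mx 0 i : E| <= 1 * r * 1.
    by apply: ler_pM => //; [rewrite mulr_ge0 // ltW|rewrite ler_wpM2r // ltW].
  by move=> /le_lt_trans; apply; rewrite /r; lra.
have coord_bound i : exists M, forall z,
    ((dot eta z + r * `|z 0 i| - M)%:E <= phi z)%E.
  have [|M1 h1] := fin_near (eta + (1 * r) *: delta_mx 0 i).
    by apply: near_e; rewrite normr1.
  have [|M2 h2] := fin_near (eta + (-1 * r) *: delta_mx 0 i).
    by apply: near_e; rewrite normrN normr1.
  have de z : dot (delta_mx 0 i) z = z 0 i.
    rewrite dotE (bigD1 i) //= mxE !eqxx mul1r big1 ?addr0 // => j ji.
    by rewrite mxE eqxx (negbTE ji) mul0r.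
  exists (Num.max M1 M2) => z.
  have M1m : M1 <= Num.max M1 M2 by rewrite le_max lexx.
  have M2m : M2 <= Num.max M1 M2 by rewrite le_max lexx orbT.
  have [zi|zi] := leP 0 (z 0 i).
    by apply: le_trans (h1 z); rewrite ger0_norm // lee_fin dotDl dotZl de; lra.
  by apply: le_trans (h2 z); rewrite ltr0_norm // lee_fin dotDl dotZl de; lra.
have [M hM] := choice coord_bound.
have [|M0 hM0] := fin_near eta; first by rewrite subrr normr0.
(* One constant for all coordinates; M0 keeps the bound nonnegative even in
   dimension 0. *)
pose B := `|M0| + \sum_i `|M i|.
have MB i : M i <= B.
  rewrite /B (bigD1 i) //= addrCA; apply: le_trans (ler_norm _) _.
  by rewrite lerDl addr_ge0 // sumr_ge0.
have M0B : M0 <= B.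
  by rewrite /B; apply: le_trans (ler_norm _) _; rewrite lerDl sumr_ge0.
have coer z : ((r * `|z| - B)%:E <= phi z + (- dot eta z)%:E)%E.
  have hz0 := hM0 z; have hz i := hM i z.
  move: hz0 hz; case: (phi z) (phi_gtNy z) => [b| |] // _; last by move=> _ _; rewrite leey.
  rewrite -EFinD !lee_fin => hz0 hz.
  suff : `|z| <= (b - dot eta z + B) / r by rewrite ler_pdivlMr // mulrC; lra.
  apply: norm_le_coord => [|i]; first by rewrite divr_ge0 ?(ltW r0) //; lra.
  rewrite ler_pdivlMr // mulrC; have := hz i; rewrite lee_fin.
  by have := MB i; lra.
have lq : lower_semicontinuous (fun z => phi z + (- dot eta z)%:E)%E.
  have -> : (fun z => phi z + (- dot eta z)%:E)%E =
            (fun z => phi z + (0 + dot (- eta) z)%:E)%E.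
    by apply/funext => z; rewrite add0r dotNl.
  by apply: lscD => //; exact: affine_continuous.
have [x hx] := coercive_lsc_min lq r0 coer.
exists x; split => // z _.
have -> : dot eta (z - x) = - dot eta x - - dot eta z by rewrite dotDr dotNr; ring.
by rewrite -lee_shift.
Qed.

End LegendreGradients.

(** * The Legendre bijection *)

Section LegendreInverse.
Context {R : realType} {n : nat}.
Local Notation E := 'rV[R]_n.
Implicit Types (u v w x y z eta zeta d : E) (a b c e r s t : R).
Context {phi : E -> \bar R} (phi_dgf : dgf phi) (phi_leg : legendre phi).

Let phi_smooth : essentially_smooth phi. Proof. by case: phi_leg. Qed.

Local Notation phis := (conj_fun phi).

(** If z stayed at distance e from x, adding the subgradient inequality at z to
    the growth of phi at x would bound the growth constant by n |eta - grad phi x|. *)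
Lemma argmax_close x e : intdom phi x -> 0 < e -> exists2 r, 0 < r &
  forall eta z, fenchel setT phi z eta -> `|eta - grad phi x| < r ->
    `|z - x| < e.
Proof.
move=> xY e0; have [c c0 hc] := growth phi_dgf phi_leg xY e0.
exists (c / (n%:R + 1)); first by rewrite divr_gt0 // ltr_wpDl.
move=> eta z zeta; rewrite ltr_pdivlMr ?ltr_wpDl // => etac.
rewrite ltNge; apply/negP => ez.
have zfin := dom_fin phi_dgf (fenchel_dom phi_dgf zeta).
have xfin := dom_fin phi_dgf (dom_intdom xY).
have := hc z ez; have [_ /(_ x I)] := zeta.
rewrite xfin zfin -!EFinD !lee_fin => h1 h2.
have z0 : 0 < `|z - x| by apply: lt_le_trans ez.
have := dot_le_norm (eta - grad phi x) (z - x); rewrite ler_norml => /andP[_ h3].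
have : c * `|z - x| <= n%:R * `|eta - grad phi x| * `|z - x|.
  by apply: le_trans h3; move: h1 h2; rewrite !dotX; lra.
rewrite ler_pM2r // => h4; have := normr_ge0 (eta - grad phi x); lra.
Qed.

Lemma conj_value y : intdom phi y ->
  phis (grad phi y) = (dot (grad phi y) y - fine (phi y))%:E.
Proof.
move=> yY; rewrite (conj_attained (grad_fenchel phi_dgf yY)).
by rewrite (dom_fin phi_dgf (dom_intdom yY)) -EFinB.
Qed.

Lemma intdom_conj_grad eta : intdom phis eta ->
  exists2 x, intdom phi x & eta = grad phi x.
Proof.
move=> /(conj_intdom_attained phi_dgf)[x xeta].
have xY := fenchel_intdom phi_dgf phi_smooth xeta.
by exists x => //; exact: fenchel_grad.
Qed.

(** With z the maximiser at eta, the error of the expansion lies between 0 and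
    <z - x, eta - grad phi x>, and z is close to x by [argmax_close]. *)
Lemma conj_has_gradient x : intdom phi x ->
  has_gradient (fine \o phis) (grad phi x) x.
Proof.
move=> xY e e0; have en : 0 < e / (n%:R + 1) by rewrite divr_gt0 // ltr_wpDl.
have [r r0 hr] := argmax_close xY en.
have etaY : \forall eta \near grad phi x, intdom phis eta.
  apply: open_nbhs_nbhs; split; first exact: open_interior.
  exact: grad_intdom_conj.
near=> eta => /=.
have etar : `|eta - grad phi x| < r by near: eta; exact: near_dist.
have [z zY etaE] : exists2 z, intdom phi z & eta = grad phi z.
  by apply: intdom_conj_grad; near: eta.
have /(hr _ _)/(_ etar) : fenchel setT phi z eta.
  by rewrite etaE; exact: grad_fenchel.
rewrite ltr_pdivlMr ?ltr_wpDl // => zx.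
have vx := conj_value xY; have := conj_value zY; rewrite -etaE => vz.
rewrite vx vz /=.
have h1 := grad_le phi_dgf xY (dom_fin phi_dgf (dom_intdom zY)).
have := grad_le phi_dgf zY (dom_fin phi_dgf (dom_intdom xY)).
rewrite -etaE => h2.
have := dot_le_norm (z - x) (eta - grad phi x); rewrite ler_norml => /andP[_ h3].
have h4 : n%:R * `|z - x| * `|eta - grad phi x| <= e * `|eta - grad phi x|.
  rewrite ler_wpM2r //; have := normr_ge0 (z - x); lra.
have h5 := mulr_ge0 (ltW e0) (normr_ge0 (eta - grad phi x)).
move: h1 h2 h3; rewrite !dotX !(dotC z) !(dotC x) => h1 h2 h3.
rewrite ler_norml; apply/andP; split; lra.
Unshelve. all: by end_near. Qed.

Lemma gradK y : intdom phi y -> grad phis (grad phi y) = y.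
Proof. by move=> /conj_has_gradient/has_gradient_differentiable[]. Qed.

Lemma grad_conjK eta : intdom phis eta -> grad phi (grad phis eta) = eta.
Proof. by move=> /intdom_conj_grad[y yY ->]; rewrite gradK. Qed.

Lemma grad_conj_intdom eta : intdom phis eta -> intdom phi (grad phis eta).
Proof. by move=> /intdom_conj_grad[y yY ->]; rewrite gradK. Qed.

Lemma grad_conj_has_gradient eta : intdom phis eta ->
  has_gradient (fine \o phis) eta (grad phis eta).
Proof.
by move=> /intdom_conj_grad[y yY ->]; rewrite gradK //; exact: conj_has_gradient.
Qed.

Lemma grad_conj_continuous eta : intdom phis eta ->
  grad phis zeta @[zeta --> eta] --> grad phis eta.
Proof.
move=> /intdom_conj_grad[y yY ->]; rewrite gradK //.
apply/(@cvgrPdist_lt R E E (nbhs (grad phi y)) _ (grad phis) y) => e e0.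
have [r r0 hr] := argmax_close yY e0.
have zetaY : \forall zeta \near grad phi y, intdom phis zeta.
  apply: open_nbhs_nbhs; split; first exact: open_interior.
  exact: grad_intdom_conj.
near=> zeta; rewrite distrC; apply: (hr zeta); last first.
  by near: zeta; exact: near_dist.
have zetaYs : intdom phis zeta by near: zeta.
rewrite -{2}(grad_conjK zetaYs); apply: grad_fenchel => //.
exact: grad_conj_intdom.
Unshelve. all: by end_near. Qed.

Lemma conj_fin eta : intdom phis eta -> phis eta = (fine (phis eta))%:E.
Proof. by move=> /intdom_conj_grad[y yY ->]; rewrite (conj_value yY). Qed.

(** The Fenchel-Young equality at grad phis eta removes the value of phi there. *)
Lemma bregman_conj x eta : intdom phis eta -> dom phi x ->
  bregman phi x (grad phis eta) =
  (fine (phi x) + fine (phis eta) - dot eta x)%:E.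
Proof.
move=> /intdom_conj_grad[y yY ->] xX; rewrite gradK // (conj_value yY) /=.
rewrite /bregman mem_set // (dom_fin phi_dgf xX) (dom_fin phi_dgf (dom_intdom yY)).
by rewrite -!EFinB !dotX; congr _%:E; ring.
Qed.

End LegendreInverse.

(** * Convex hulls of compact sets *)

Section ConvexHulls.
Context {R : realType} {n : nat}.
Local Notation E := 'rV[R]_n.
Implicit Types (x y z d p : E) (b c e r s t : R) (A C : set E).

Lemma convex_set_sum N C (w : 'I_N -> R) (a : 'I_N -> E) :
  @convex_set R E C -> (forall i, 0 <= w i) -> \sum_i w i = 1 ->
  (forall i, C (a i)) -> C (\sum_i w i *: a i).
Proof.
move=> cC; elim: N w a => [|N IHN] w a w0 w1 aC.
  by move: w1; rewrite big_ord0 => /eqP; rewrite eq_sym oner_eq0.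
move: w1; rewrite !big_ord_recl; set W := \sum_(i < N) _ => w1.
have W0 : 0 <= W by rewrite sumr_ge0.
have [W00|WN0] := eqVneq W 0.
  have wi0 i : w (lift ord0 i) = 0.
    apply/eqP; move: W00 => /eqP; rewrite psumr_eq0 // => /allP/(_ i).
    by rewrite mem_index_enum => /(_ isT).
  rewrite big1 ?addr0; last by move=> i _; rewrite wi0 scale0r.
  by move: w1; rewrite W00 addr0 => ->; rewrite scale1r.
have -> : \sum_(i < N) w (lift ord0 i) *: a (lift ord0 i) =
    (1 - w ord0) *: \sum_(i < N) (w (lift ord0 i) / W) *: a (lift ord0 i).
  rewrite scaler_sumr; apply: eq_bigr => i _; rewrite scalerA.
  by congr (_ *: _); rewrite -w1 addrAC subrr add0r mulrC divfK.
apply: convex_set_itv => //; last by lra.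
by apply: IHN => // [i|]; [rewrite divr_ge0|rewrite -mulr_suml divff].
Qed.

(** The n + 2 rows (1, a_i) live in dimension n + 1, so they satisfy a nontrivial
    relation mu. Its coefficients sum to 0, so some are positive; subtracting
    the multiple of mu given by the least ratio w_j / mu_j with mu_j > 0 kills
    w_j and keeps all weights nonnegative. *)
Lemma caratheodory_step (w : 'I_n.+2 -> R) (a : 'I_n.+2 -> E) :
  (forall i, 0 <= w i) -> exists w' : 'I_n.+2 -> R,
  [/\ forall i, 0 <= w' i, \sum_i w' i = \sum_i w i,
      \sum_i w' i *: a i = \sum_i w i *: a i & exists j, w' j = 0].
Proof.
move=> w0.
pose B : 'M[R]_(n.+2, 1 + n) := row_mx (const_mx 1) (\matrix_(i, j) a i 0 j).
have kB : kermx B != 0.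
  rewrite -mxrank_eq0 mxrank_ker -lt0n subn_gt0.
  by rewrite (leq_ltn_trans (rank_leq_col B)).
have /rowV0Pn[mu /sub_kermxP muB mu0] := kB.
move: muB; rewrite mul_mx_row => /eqP; rewrite row_mx_eq0 => /andP[/eqP m1 /eqP m2].
have mu_sum : \sum_i mu 0 i = 0.
  have := congr1 (fun M : 'M[R]_(1, 1) => M 0 0) m1; rewrite !mxE => m1'.
  rewrite -[RHS]m1'.
  by apply: eq_bigr => i _; rewrite !mxE mulr1.
have mu_a : \sum_i mu 0 i *: a i = 0.
  rewrite -[RHS]m2; apply/rowP => j; rewrite summxE mxE.
  by apply: eq_bigr => i _; rewrite !mxE.
have [i0 i0p] : exists i, 0 < mu 0 i.
  apply: contrapT => Np; move/eqP: mu0; apply; apply/rowP => i; rewrite mxE.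
  have Nmu j : 0 <= - mu 0 j.
    by rewrite oppr_ge0 leNgt; apply/negP => mj; apply: Np; exists j.
  have /eqP : \sum_i - mu 0 i = 0 by rewrite sumrN mu_sum oppr0.
  rewrite psumr_eq0 // => /allP/(_ i); rewrite mem_index_enum => /(_ isT).
  by rewrite oppr_eq0 => /eqP.
have [j jp jmin] := @arg_minP _ _ _ i0 (fun i => 0 < mu 0 i) (fun i => w i / mu 0 i) i0p.
have t0 : 0 <= w j / mu 0 j by rewrite divr_ge0 // ltW.
exists (fun i => w i - w j / mu 0 j * mu 0 i); split.
- move=> i; rewrite subr_ge0; have [ip|ip] := ltP 0 (mu 0 i).
    by rewrite -ler_pdivlMr //; exact: jmin.
  by apply: le_trans (w0 i); rewrite mulr_ge0_le0.
- by rewrite sumrB -mulr_sumr mu_sum mulr0 subr0.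
- under eq_bigr do rewrite scalerBl -scalerA.
  by rewrite sumrB -scaler_sumr mu_a scaler0 subr0.
- by exists j; rewrite divfK ?subrr // gt_eqF.
Qed.

(** Among convex combinations of n + 2 points of A, a compact family, take one
    closest to x. After a Caratheodory step one slot is free. A point a of A with
    <x - p, a - x> >= 0, put into that slot with small weight, would decrease the
    distance from p to x unless p = x. The number of points is fixed in advance,
    so the conclusion is about the convex hull itself and not its closure. *)
Lemma conv_of_support A x : compact A ->
  (forall d, exists2 a, A a & 0 <= dot d (a - x)) ->
  smallest (@convex_set R E) A x.
Proof.
move=> cA supp; have [a0 a0A _] := supp 0.
(* A configuration assigns to each of the n + 2 slots a weight and a point. *)
pose T := prod_topology (fun _ : 'I_n.+2 => (R * E)%type).
pose P (v : T) : E := \sum_i (v i).1 *: (v i).2.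
pose W (v : T) : R := \sum_i (v i).1.
pose K := [set v : T | forall i, (`[0, 1]%classic `*` A) (v i)] `&` W @^-1` [set 1].
have cW : continuous W.
  move=> v; apply: (@cvg_big R^o _ +%R 0 predT (@add_continuous R^o) T (nbhs v) _
    (fun i (v : T) => (v i).1) (fun i => (v i).1) (nbhs_filter v)) => i _.
  apply: (@continuous_comp T (R * E)%type R (fun v : T => v i) fst).
    exact: (@proj_continuous _ _ i).
  exact: cvg_fst.
have cP : continuous P.
  move=> v; apply: (@cvg_big E _ +%R 0 predT (@add_continuous E) T (nbhs v) _
    (fun i (v : T) => (v i).1 *: (v i).2) (fun i => (v i).1 *: (v i).2) (nbhs_filter v)) => i _.
  apply: (@cvgZ R E T (nbhs v) (nbhs_filter v)
    (fun v : T => (v i).1) (fun v : T => (v i).2) (v i).1 (v i).2).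
    apply: (@continuous_comp T (R * E)%type R (fun v : T => v i) fst).
      exact: (@proj_continuous _ _ i).
    exact: cvg_fst.
  apply: (@continuous_comp T (R * E)%type E (fun v : T => v i) snd).
    exact: (@proj_continuous _ _ i).
  exact: cvg_snd.
have cK : compact K.
  apply: compact_closedI.
    apply: (@tychonoff _ (fun _ : 'I_n.+2 => (R * E)%type)
      (fun _ => `[0, 1]%classic `*` A)) => i.
    by apply: compact_setX => //; exact: segment_compact.
  by apply: closed_comp; [move=> v _; exact: cW|exact: closed_eq].
have K0 : K !=set0.
  exists (fun i : 'I_n.+2 => (if i == ord0 then 1 else 0, a0)); split.
    move=> i; split => //=; rewrite in_itv /=.
    by case: ifP => _; rewrite lexx ler01.
  by rewrite /= /W /= -big_mkcond /= big_pred1_eq.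
pose F v := dot (P v - x) (P v - x).
have cF : {within K, continuous F}.
  apply: continuous_subspaceT => v.
  have -> : F = (fun z => 0 + dot 0 z + 1 * dot (z - x) (z - x)) \o P.
    by apply/funext => v1; rewrite /F /= dot0l addr0 add0r mul1r.
  apply: (@continuous_comp T E R P _ v); first exact: cP.
  exact: quadratic_continuous.
have [v vK vmin] := compact_EVT_min K0 cK cF.
move: vK; rewrite inE => -[vI vW].
have v0 i : 0 <= (v i).1 by have [+ _] := vI i; rewrite /= in_itv => /andP[].
have vA i : A (v i).2 by have [] := vI i.
have Px : P v = x.
  have [w' [w0 w1 wP [j wj]]] := caratheodory_step (fun i => (v i).2) v0.
  have [a aA ha] := supp (x - P v).
  (* Weight s for a in the freed slot j, and 1 - s shared by the others, moves
     the combination from p to p + s (a - p). *)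
  have better s : 0 < s -> s <= 1 ->
      F v <= dot (P v + s *: (a - P v) - x) (P v + s *: (a - P v) - x).
    move=> s0 s1.
    pose v' : T := fun i => if i == j then (s, a) else ((1 - s) * w' i, (v i).2).
    have wle i : w' i <= 1.
      move: vW; rewrite /= /W -w1 (bigD1 i) //= => <-.
      by rewrite lerDl sumr_ge0.
    have Pv' : P v' = P v + s *: (a - P v).
      rewrite /P -wP (bigD1 j) //= /v' eqxx /= [in RHS](bigD1 j) //= wj scale0r add0r.
      have -> : \sum_(i < n.+2 | i != j) (if i == j then (s, a) else ((1 - s) * w' i, (v i).2)).1 *:
         (if i == j then (s, a) else ((1 - s) * w' i, (v i).2)).2 =
         (1 - s) *: \sum_(i < n.+2 | i != j) w' i *: (v i).2.
        rewrite scaler_sumr; apply: eq_bigr => i /negbTE ij.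
        by rewrite ij /= scalerA.
      by apply/rowP => i; rewrite !mxE; ring.
    rewrite -Pv'; apply: vmin; rewrite inE; split.
      move=> i; rewrite /v'; case: ifP => _; split => //=; rewrite in_itv /=.
        by rewrite (ltW s0).
      rewrite mulr_ge0 ?subr_ge0 //=; apply: le_trans (wle i).
      by rewrite ler_piMl // gerBl ltW.
    rewrite /= /W (bigD1 j) //= /v' eqxx /=.
    have -> : \sum_(i < n.+2 | i != j) (if i == j then (s, a) else ((1 - s) * w' i, (v i).2)).1 =
         (1 - s) * \sum_(i < n.+2 | i != j) w' i.
      by rewrite mulr_sumr; apply: eq_bigr => i /negbTE ij; rewrite ij.
    have : \sum_(i < n.+2 | i != j) w' i = 1.
      by move: vW; rewrite /= /W -w1 (bigD1 j) //= wj add0r.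
    by move=> ->; ring.
  apply/eqP; rewrite -subr_eq0; apply/eqP/dot_eq0.
  rewrite leNgt; apply/negP => D0.
  have [s /andP[s0 s1] sD] := small_step D0 (dot_ge0 (a - P v)).
  have := better s s0 s1; rewrite /F => hs.
  have : s * dot (P v - x) (P v - x) <= s * (s * dot (a - P v) (a - P v)).
    move: hs D0 ha; move: (P v) => p.
    rewrite !dotX !(dotC x) !(dotC p a); move=> hs D0 ha; nra.
  by rewrite ler_pM2l // leNgt sD.
rewrite -Px => C [cC AC]; apply: convex_set_sum => // i.
exact: AC.
Qed.

End ConvexHulls.

(** * Level subdifferentials and proximal maps *)

Section LeftOperators.
Context {R : realType} {n : nat}.
Local Notation E := 'rV[R]_n.
Implicit Types (u v w x y z d : E) (e r s t : R).
Context {phi : E -> \bar R} (phi_dgf : dgf phi).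
Context {lam : R} (lam0 : 0 < lam).
Implicit Types (f g : E -> \bar R).

Let phi_gtNy x : (-oo < phi x)%E.
Proof. by case: phi_dgf => -[+ _] _ _ _ _; apply. Qed.

Lemma bregman_fin x y : dom phi x -> intdom phi y -> bregman phi x y =
  (fine (phi x) - fine (phi y) - dot (grad phi y) (x - y))%:E.
Proof.
move=> xX yY; rewrite /bregman mem_set // (dom_fin phi_dgf xX).
by rewrite (dom_fin phi_dgf (dom_intdom yY)) -!EFinB.
Qed.

(** The differential terms of D(z, x) add up to a change of slope by
    lam^-1 grad phi x. All terms moved across the inequality are finite, so f
    may take infinite values. *)
Lemma left_levelP f x u : left_level phi lam f x u <-> intdom phi x /\
  fenchel (dom phi) (fun x => f x + (lam^-1)%:E * phi x)%E x
    (u + lam^-1 *: grad phi x).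
Proof.
have E z : intdom phi x -> dom phi z ->
    (f x + (dot u (z - x))%:E - (lam^-1)%:E * bregman phi z x <= f z)%E =
    (f x + (lam^-1)%:E * phi x + (dot (u + lam^-1 *: grad phi x) (z - x))%:E
      <= f z + (lam^-1)%:E * phi z)%E.
  move=> xY zX.
  rewrite (bregman_fin zX xY) (dom_fin phi_dgf zX) (dom_fin phi_dgf (dom_intdom xY)).
  rewrite -!EFinM -!addeA -EFinB -EFinD lee_shift.
  by congr (_ + _%:E <= _)%E; rewrite !dotX; ring.
split => -[xY hu]; split => //; first (split; first exact: dom_intdom).
  by move=> z zX; rewrite -E //; exact: hu.
by move=> z zX; rewrite E //; have [_ /(_ z zX)] := hu.
Qed.

Lemma left_proxP f y x : left_prox phi lam f y x <-> intdom phi y /\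
  fenchel (dom phi) (fun x => phi x + lam%:E * f x)%E x (grad phi y).
Proof.
have E z : intdom phi y -> dom phi x -> dom phi z ->
    (left_objective phi lam f y x <= left_objective phi lam f y z)%E =
    (phi x + lam%:E * f x + (dot (grad phi y) (z - x))%:E
      <= phi z + lam%:E * f z)%E.
  move=> yY xX zX; rewrite /left_objective !bregman_fin //.
  rewrite (dom_fin phi_dgf zX) (dom_fin phi_dgf xX) -!EFinM lee_shift.
  rewrite [((fine (phi x))%:E + _)%E]addeC [((fine (phi z))%:E + _)%E]addeC.
  rewrite -addeA -EFinD lee_scale_shift //.
  by congr (_ + _%:E <= _)%E; rewrite !dotX; ring.
split=> [[yY [xX hx]]|[yY [xX hx]]]; split => //; split => // z zX.
  by rewrite -E //; exact: hx.
by rewrite E //; exact: hx.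
Qed.

Lemma left_level_subset_frechet f :
  op_subset (left_level phi lam f) (frechet (dom phi) f).
Proof.
move=> x u /left_levelP[xY /fenchel_frechet xu].
have := has_gradientZ (- lam^-1) (grad_has_gradient phi_dgf xY).
move=> /frechet_sum-/(_ _ _ f _ _ ltr01 _ xu).
rewrite scale1r scaleNr addrK; apply=> z zX /=.
rewrite (dom_fin phi_dgf zX) /= -EFinM mul1e -addeA -EFinD.
by rewrite mulNr addrN adde0.
Qed.

Lemma left_level_fenchel f : left_level phi lam f =
  op_sub (op_restr (fenchel (dom phi) (fun x => f x + (lam^-1)%:E * phi x)%E)
            (dom phi)°)
    (op_scale lam^-1 (op_fun (intdom phi) (grad phi))).
Proof.
apply/funext => x; apply/seteqP; split => u.
  move=> /left_levelP[xY xu]; exists (u + lam^-1 *: grad phi x) => //.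
  exists (lam^-1 *: grad phi x); first by exists (grad phi x).
  by rewrite addrK.
move=> [v [xY xv] [_ [_ [_ ->] <-] <-]].
by apply/left_levelP; rewrite subrK.
Qed.

Lemma left_prox_fenchel f : left_prox phi lam f =
  op_comp (op_inv (fenchel (dom phi) (fun x => phi x + lam%:E * f x)%E))
    (op_fun (intdom phi) (grad phi)).
Proof.
apply/funext => y; apply/seteqP; split => x.
  by move=> /left_proxP[yY xy]; exists (grad phi y).
by move=> [_ [yY ->] xy]; apply/left_proxP.
Qed.

Lemma fenchel_scale f x u : dom phi x ->
  fenchel (dom phi) (fun x => phi x + lam%:E * f x)%E x u <->
  fenchel (dom phi) (fun x => f x + (lam^-1)%:E * phi x)%E x (lam^-1 *: u).
Proof.
have E z : dom phi x -> dom phi z ->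
    (phi x + lam%:E * f x + (dot u (z - x))%:E <= phi z + lam%:E * f z)%E =
    (f x + (lam^-1)%:E * phi x + (dot (lam^-1 *: u) (z - x))%:E
      <= f z + (lam^-1)%:E * phi z)%E.
  move=> xX zX; rewrite (dom_fin phi_dgf zX) (dom_fin phi_dgf xX) -!EFinM.
  rewrite [((fine (phi x))%:E + _)%E]addeC [((fine (phi z))%:E + _)%E]addeC.
  rewrite -!addeA -!EFinD lee_scale_shift // lee_shift.
  by congr (_ + _%:E <= _)%E; rewrite !dotX; ring.
by move=> xX; split => -[_ h]; split => // z zX; have := h z zX; rewrite E.
Qed.

Lemma intdom_left_prox f : op_cap (dom phi)° (left_prox phi lam f) =
  op_comp (op_inv (op_add (op_fun (intdom phi) (grad phi))
                          (op_scale lam (left_level phi lam f))))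
    (op_fun (intdom phi) (grad phi)).
Proof.
apply/funext => y; apply/seteqP; split => x.
  move=> [xY /left_proxP[yY /(fenchel_scale _ _ (dom_intdom xY)) xy]].
  exists (grad phi y) => //.
  exists (grad phi x) => //; exists (grad phi y - grad phi x); last by rewrite subrKC.
  exists (lam^-1 *: (grad phi y - grad phi x)).
    by apply/left_levelP; rewrite scalerBr subrK.
  by rewrite scalerA divff ?scale1r // gt_eqF.
move=> [_ [yY ->] [_ [xY ->] [_ [u /left_levelP[_ xu] <-] yE]]].
split => //; apply/left_proxP; split => //.
apply/(fenchel_scale _ _ (dom_intdom xY)).
by rewrite -yE scalerDr scalerA mulVf ?gt_eqF // scale1r addrC.
Qed.

Lemma right_levelP g y v : right_level phi lam g y v <-> intdom phi y /\
  forall z, intdom phi z -> (g y + (dot v (grad phi z - grad phi y)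
    - lam^-1 * (fine (phi y) - fine (phi z) - dot (grad phi z) (y - z)))%:E <= g z)%E.
Proof.
split => -[yY h]; split => // z zY; have := h z zY;
  by rewrite (bregman_fin (dom_intdom yY) zY) -addeA -EFinB.
Qed.

Lemma right_proxP g x y : right_prox phi lam g x y <->
  [/\ dom phi x, intdom phi y & forall z, intdom phi z ->
    (g y + (lam^-1 * (fine (phi z) - fine (phi y) - dot (grad phi y) (x - y)
       + dot (grad phi z) (x - z)))%:E <= g z)%E].
Proof.
have E z : dom phi x -> intdom phi y -> intdom phi z ->
    (right_objective phi lam g x y <= right_objective phi lam g x z)%E =
    (g y + (lam^-1 * (fine (phi z) - fine (phi y) - dot (grad phi y) (x - y)
       + dot (grad phi z) (x - z)))%:E <= g z)%E.
  move=> xX yY zY; rewrite /right_objective !bregman_fin // -!EFinM lee_shift.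
  by congr (_ + _%:E <= _)%E; move: (grad phi y) (grad phi z) => dy dz; ring.
split=> [[xX [yY h]]|[xX yY h]].
  by split => // z zY; rewrite -E //; exact: h.
by split => //; split => // z zY; rewrite E //; exact: h.
Qed.

Lemma right_prox_level g : right_prox phi lam g =
  op_restr (op_inv (op_add op_id (op_scale lam (right_level phi lam g))))
    (dom phi).
Proof.
apply/funext => x; apply/seteqP; split => y.
  move=> /right_proxP[xX yY h]; split => //.
  exists y => //; exists (x - y); last by rewrite subrKC.
  exists (lam^-1 *: (x - y)); last by rewrite scalerA divff ?scale1r // gt_eqF.
  apply/right_levelP; split => // z zY; have := h z zY.
  congr (_ + _%:E <= _)%E; move: (grad phi y) (grad phi z) => dy dz.
  by rewrite !dotX !(dotC x) !(dotC y); ring.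
move=> [xX [_ -> [_ [v /right_levelP[yY h] <-] xE]]].
apply/right_proxP; split => // z zY; have := h z zY.
have -> : v = lam^-1 *: (x - y).
  by rewrite -xE addrAC subrr add0r scalerA mulVf ?gt_eqF // scale1r.
congr (_ + _%:E <= _)%E; move: (grad phi y) (grad phi z) => dy dz.
by rewrite !dotX !(dotC x) !(dotC y); ring.
Qed.

End LeftOperators.

(** * Proximal maps in the dual variable *)

Section LegendreOperators.
Context {R : realType} {n : nat}.
Local Notation E := 'rV[R]_n.
Implicit Types (u v w x y z eta zeta d : E) (e r s t : R).

Lemma fenchel_monotone (S : set E) (h : E -> \bar R) x y u v :
  proper_on S h -> fenchel S h x u -> fenchel S h y v ->
  0 <= dot (u - v) (x - y).
Proof.
move=> [hNy [z0 Sz0 z0y]].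
have fin z w : fenchel S h z w -> exists r, h z = r%:E.
  move=> [Sz /(_ z0 Sz0)]; case: (h z) (hNy z Sz) => [r| |] // _; first by exists r.
  by rewrite leye_eq; case: (h z0) z0y.
move=> xu yv; have [a xa] := fin _ _ xu; have [b yb] := fin _ _ yv.
have [Sx hx] := xu; have [Sy hy] := yv.
have := hx y Sy; have := hy x Sx; rewrite xa yb -!EFinD !lee_fin !dotX; lra.
Qed.

Context {phi : E -> \bar R} (phi_dgf : dgf phi) (phi_leg : legendre phi).
Context {lam : R} (lam0 : 0 < lam).
(* Of G, the gradient of the conjugate, only the duality facts below are used. *)
Context {G : E -> E} (GE : G = grad (conj_fun phi)).
Implicit Types (f g : E -> \bar R).

Let phi_gtNy x : (-oo < phi x)%E.
Proof. by case: phi_dgf => -[+ _] _ _ _ _; apply. Qed.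

Local Notation X := (dom phi).
Local Notation Y := (intdom phi).
Local Notation phis := (conj_fun phi).
Local Notation Ys := (intdom phis).
Local Notation Dphi := (op_fun Y (grad phi)).
Local Notation Dphis := (op_fun Ys (G)).

Let GK eta : Ys eta -> grad phi (G eta) = eta.
Proof. by rewrite GE; exact: grad_conjK. Qed.

Let grad_G y : Y y -> G (grad phi y) = y.
Proof. by rewrite GE; exact: gradK. Qed.

Let G_intdom eta : Ys eta -> Y (G eta).
Proof. by rewrite GE; exact: grad_conj_intdom. Qed.

Let G_has_gradient eta : Ys eta -> has_gradient (fine \o phis) eta (G eta).
Proof. by rewrite GE; exact: grad_conj_has_gradient. Qed.

Let G_continuous eta : Ys eta -> G zeta @[zeta --> eta] --> G eta.
Proof. by rewrite GE; exact: grad_conj_continuous. Qed.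

Let bregman_G x eta : Ys eta -> X x -> bregman phi x (G eta) =
  (fine (phi x) + fine (phis eta) - dot eta x)%:E.
Proof. by rewrite GE; exact: bregman_conj. Qed.

Let phis_fin eta : Ys eta -> phis eta = (fine (phis eta))%:E.
Proof. exact: conj_fin. Qed.

Lemma young eta : Ys eta ->
  fine (phi (G eta)) = dot eta (G eta) - fine (phis eta).
Proof.
move=> /(intdom_conj_grad phi_dgf phi_leg)[y yY ->].
rewrite (grad_G yY) (conj_value phi_dgf yY) /=; ring.
Qed.

Lemma intdom_grad_conj z : Y z -> exists2 zeta, Ys zeta & z = G zeta.
Proof.
by move=> zY; exists (grad phi z); [exact: grad_intdom_conj|rewrite (grad_G zY)].
Qed.

Lemma right_level_dualP g eta v : Ys eta ->
  right_level phi lam g (G eta) v <->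
  fenchel Ys (fun zeta => g (G zeta) + (lam^-1)%:E * phis zeta)%E eta
    (v + lam^-1 *: G eta).
Proof.
move=> etaY; have yY := G_intdom etaY.
have E zeta : Ys zeta ->
    (g (G eta) + (dot v (grad phi (G zeta) - grad phi (G eta)))%:E
       - (lam^-1)%:E * bregman phi (G eta) (G zeta)
     <= g (G zeta))%E =
    (g (G eta) + (lam^-1)%:E * phis eta
       + (dot (v + lam^-1 *: G eta) (zeta - eta))%:E
     <= g (G zeta) + (lam^-1)%:E * phis zeta)%E.
  move=> zetaY.
  have -> : dot v (grad phi (G zeta) - grad phi (G eta))
      = dot v (zeta - eta).
    exact (f_equal2 (fun a b => dot v (a - b)) (GK zetaY)
      (GK etaY)).
  rewrite (bregman_G zetaY (dom_intdom yY)) (young etaY).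
  rewrite (phis_fin zetaY) (phis_fin etaY).
  rewrite -!EFinM -!addeA -EFinB -EFinD lee_shift.
  move: (G eta) => y; congr (_ + _%:E <= _)%E.
  by rewrite !dotX !(dotC y) /=; ring.
split => -[h1 h2]; split => // z zY.
  by rewrite -E //; apply: h2; exact: G_intdom.
by have [zeta zetaY ->] := intdom_grad_conj zY; rewrite E //; exact: h2.
Qed.

Lemma right_level_fenchel g : op_comp (right_level phi lam g) Dphis =
  op_sub (fenchel Ys (fun eta => g (G eta) + (lam^-1)%:E * phis eta)%E)
    (op_scale lam^-1 Dphis).
Proof.
apply/funext => eta; apply/seteqP; split => v.
  move=> [_ [etaY ->] /(right_level_dualP _ _ etaY) h].
  exists (v + lam^-1 *: G eta) => //.
  by exists (lam^-1 *: G eta); [exists (G eta)|rewrite addrK].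
move=> [w h [_ [_ [etaY ->] <-] <-]]; exists (G eta) => //.
by apply/right_level_dualP => //; rewrite subrK.
Qed.

Lemma right_level_subset_frechet g : op_subset
  (op_comp (right_level phi lam g) Dphis)
  (frechet Ys (fun eta => g (G eta))).
Proof.
move=> eta v [_ [etaY ->] /(right_level_dualP _ _ etaY)/fenchel_frechet h].
have := has_gradientZ (- lam^-1) (G_has_gradient etaY).
move=> /frechet_sum-/(_ _ _ (fun eta => g (G eta)) _ _ ltr01 _ h).
rewrite scale1r scaleNr addrK; apply=> z zX /=.
rewrite (phis_fin zX) /= -EFinM mul1e -addeA -EFinD.
by rewrite mulNr addrN adde0.
Qed.

Lemma right_prox_dualP g x eta : Ys eta ->
  right_prox phi lam g x (G eta) <-> X x /\
  fenchel Ys (fun eta => phis eta + lam%:E * g (G eta))%E eta x.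
Proof.
move=> etaY; have yY := G_intdom etaY.
have obj zeta : X x -> Ys zeta -> right_objective phi lam g x (G zeta) =
    (g (G zeta)
      + (lam^-1 * (fine (phi x) + fine (phis zeta) - dot zeta x))%:E)%E.
  by move=> xX zetaY; rewrite /right_objective (bregman_G zetaY xX).
have E zeta : X x -> Ys zeta ->
    (right_objective phi lam g x (G eta)
      <= right_objective phi lam g x (G zeta))%E =
    (phis eta + lam%:E * g (G eta) + (dot x (zeta - eta))%:E
      <= phis zeta + lam%:E * g (G zeta))%E.
  move=> xX zetaY; apply: etrans.
    exact (f_equal2 (fun a b => a <= b)%E (obj _ xX etaY) (obj _ xX zetaY)).
  rewrite (phis_fin zetaY) (phis_fin etaY).
  move: (g (G eta)) (g (G zeta)) => a b.
  rewrite lee_shift !(addeC (fine _)%:E) -addeA -EFinD lee_scale_shift //=.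
  by congr (_ + _%:E <= _)%E; rewrite !dotX !(dotC x); ring.
split=> [[xX [_ h]]|[xX [_ h]]]; split => //; split => // z zY.
  by rewrite -E //; apply: h; exact: G_intdom.
by have [zeta zetaY ->] := intdom_grad_conj zY; rewrite E //; exact: h.
Qed.

Lemma right_prox_fenchel g : op_comp Dphi (right_prox phi lam g) =
  op_restr (op_inv
    (fenchel Ys (fun eta => phis eta + lam%:E * g (G eta))%E)) X.
Proof.
apply/funext => x; apply/seteqP; split => eta.
  move=> [y xy [yY ->]]; have etaY := grad_intdom_conj phi_dgf phi_leg yY.
  by apply/right_prox_dualP => //; rewrite (grad_G yY).
move=> [xX h]; have etaY : Ys eta by have [] := h.
exists (G eta); first exact/right_prox_dualP.
by split; [exact: G_intdom|rewrite (GK etaY)].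
Qed.

Lemma left_prox_dual f : op_comp (left_prox phi lam f) Dphis =
  op_restr (op_inv (fenchel X (fun x => phi x + lam%:E * f x)%E)) Ys.
Proof.
apply/funext => eta; apply/seteqP; split => x.
  by move=> [_ [etaY ->] /(left_proxP phi_dgf lam0)[_]]; rewrite (GK etaY).
move=> [etaY h]; exists (G eta) => //.
apply/left_proxP => //; split; first exact: G_intdom.
by rewrite (GK etaY).
Qed.

Lemma scale_gtNy (a : \bar R) : (-oo < a)%E -> (-oo < lam%:E * a)%E.
Proof.
case: a => [a| |] //; first by rewrite -EFinM !ltNyr.
by rewrite gt0_muley ?lte_fin.
Qed.

Lemma scale_lty (a : \bar R) : (a < +oo)%E -> (lam%:E * a < +oo)%E.
Proof.
case: a => [a| |] //; first by rewrite -EFinM !ltry.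
by rewrite gt0_muleNy ?lte_fin.
Qed.

Lemma left_prox_monotone f : proper_on X f ->
  monotone_op (op_comp (left_prox phi lam f) Dphis).
Proof.
move=> [fNy [x0 Xx0 fx0]] eta x eta' x'; rewrite left_prox_dual.
move=> [_ h] [_ h']; apply: fenchel_monotone h h'; split.
  by move=> z zX; apply: adde_ltNy => //; exact/scale_gtNy/fNy.
exists x0 => //; rewrite (dom_fin phi_dgf Xx0).
by case: (lam%:E * f x0)%E (scale_lty fx0) => [r| |] // _; rewrite -EFinD ltry.
Qed.

Lemma right_prox_monotone g : proper_on Y g ->
  monotone_op (op_comp Dphi (right_prox phi lam g)).
Proof.
move=> [gNy [y0 Yy0 gy0]] x eta x' eta'; rewrite right_prox_fenchel.
move=> [_ h] [_ h']; apply: fenchel_monotone h h'; split.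
  move=> z zY; apply: adde_ltNy; first by rewrite (phis_fin zY) ltNyr.
  exact/scale_gtNy/gNy/G_intdom.
have [zeta zetaY yE] := intdom_grad_conj Yy0.
exists zeta => //; rewrite -yE (phis_fin zetaY).
by case: (lam%:E * g y0)%E (scale_lty gy0) => [r| |] // _; rewrite -EFinD ltry.
Qed.

Local Notation ht f := (fun x => phi x + lam%:E * extend X f x)%E.

Lemma ht_dom f x : X x -> ht f x = (phi x + lam%:E * f x)%E.
Proof. by move=> xX; rewrite /extend mem_set. Qed.

Lemma ht_ndom f x : ~ X x -> ht f x = +oo%E.
Proof.
move=> xX; rewrite /extend memNset // gt0_muley ?lte_fin //.
by case: (phi x) (phi_gtNy x).
Qed.

Lemma ht_fenchel f x u :
  fenchel X (fun x => phi x + lam%:E * f x)%E x u <->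
  X x /\ fenchel setT (ht f) x u.
Proof.
split=> [[xX h]|[xX [_ h]]]; split => //.
  split => // z _; have [zX|zX] := pselect (X z); last by rewrite (ht_ndom _ zX) leey.
  by rewrite !ht_dom //; exact: h.
by move=> z zX; have := h z I; rewrite !ht_dom.
Qed.

Lemma eq_of_real_bounds (a b : \bar R) :
  (forall r, (a <= r%:E)%E = (b <= r%:E)%E) -> a = b.
Proof.
move=> ab; apply/eqP; rewrite eq_le; apply/andP; split.
  case: b ab => [b| |] ab; [by rewrite ab|by rewrite leey|].
  apply: contraT; rewrite -ltNge => /real_between[r _ ra].
  by have := ab r; rewrite leNye leNgt ra.
case: a ab => [a| |] ab; [by rewrite -ab|by rewrite leey|].
apply: contraT; rewrite -ltNge => /real_between[r _ ra].
by have := ab r; rewrite leNye leNgt ra.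
Qed.

(** Substituting [bregman_conj] turns the infimum over X into minus a conjugate. *)
Lemma left_env_conj f eta : Ys eta -> (- left_env phi lam f (G eta) =
  (lam^-1)%:E * conj_fun (ht f) eta + (- lam^-1 * fine (phis eta))%:E)%E.
Proof.
move=> etaY; apply: eq_of_real_bounds => r.
have -> : ((lam^-1)%:E * conj_fun (ht f) eta + (- lam^-1 * fine (phis eta))%:E <= r%:E)%E
    = (conj_fun (ht f) eta <= (lam * r + fine (phis eta))%:E)%E.
  have l0 : (0 < (lam^-1)%:E)%E by rewrite lte_fin invr_gt0.
  case: (conj_fun _ _) => [a| |]; rewrite ?(gt0_muley l0) ?(gt0_muleNy l0) ?leNye //.
  rewrite -EFinM -EFinD !lee_fin -(ler_pM2l lam0).
  have -> : lam * (lam^-1 * a + - lam^-1 * fine (phis eta)) = a - fine (phis eta).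
    by field; rewrite gt_eqF.
  by apply/idP/idP; lra.
have E z : X z -> ((- r)%:E <= left_objective phi lam f (G eta) z)%E =
    ((dot eta z - (lam * r + fine (phis eta)))%:E <= ht f z)%E.
  move=> zX; rewrite ht_dom // /left_objective (bregman_G etaY zX) (dom_fin phi_dgf zX).
  have l0 : (0 < lam%:E)%E by rewrite lte_fin.
  rewrite -EFinM; case: (f z) => [a| |]; rewrite ?(gt0_muley l0) ?(gt0_muleNy l0) ?leey //=.
  rewrite -!EFinM -!EFinD !lee_fin -(ler_pM2l lam0).
  have -> : lam * (a + lam^-1 * (fine (phi z) + fine (phis eta) - dot eta z)) =
     lam * a + (fine (phi z) + fine (phis eta) - dot eta z).
    by field; rewrite gt_eqF.
  by apply/idP/idP; lra.
rewrite leeNl -EFinN; apply/idP/idP.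
  move=> /ereal_infP h; apply/conj_le => z.
  have [zX|zX] := pselect (X z); last by rewrite (ht_ndom _ zX) leey.
  by rewrite -E //; apply: h; exists z.
move=> /conj_le h; apply/ereal_infP => _ [z zX <-].
by rewrite E //; exact: h.
Qed.

Lemma conj_left_env f eta : Ys eta -> (conj_fun (ht f) eta =
  lam%:E * - left_env phi lam f (G eta) + (fine (phis eta))%:E)%E.
Proof.
move=> etaY; rewrite left_env_conj //.
have l0 : (0 < lam%:E)%E by rewrite lte_fin.
have l0' : (0 < (lam^-1)%:E)%E by rewrite lte_fin invr_gt0.
case: (conj_fun _ _) => [a| |]; rewrite ?(gt0_muley l0') ?(gt0_muleNy l0').
- transitivity (lam * (lam^-1 * a + - lam^-1 * fine (phis eta)) + fine (phis eta))%:E.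
    by congr _%:E; field; exact: lt0r_neq0.
  by rewrite !EFinD !EFinM EFinD EFinM.
- by rewrite gt0_muley.
- by rewrite gt0_muleNy.
Qed.

Lemma ht_gtNy f x : (forall x, X x -> (-oo < f x)%E) -> (-oo < ht f x)%E.
Proof.
move=> fNy; have [xX|xX] := pselect (X x); last by rewrite (ht_ndom _ xX).
by rewrite ht_dom //; apply: adde_ltNy => //; exact/scale_gtNy/fNy.
Qed.

Lemma ht_proper f : proper_on X f -> proper_on setT (ht f).
Proof.
move=> [fNy [x0 Xx0 fx0]]; split => [x _|]; first exact: ht_gtNy.
exists x0 => //; rewrite ht_dom // (dom_fin phi_dgf Xx0).
by case: (lam%:E * f x0)%E (scale_lty fx0) => [r| |] // _; rewrite -EFinD ltry.
Qed.

Lemma left_prox_subset_limiting f : (forall x, X x -> (-oo < f x)%E) ->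
  op_subset (op_comp (left_prox phi lam f) Dphis)
            (op_restr (limiting setT (conj_fun (ht f))) Ys).
Proof.
move=> fNy eta x; rewrite left_prox_dual => -[etaY /ht_fenchel[xX h]].
split => //; apply: frechet_limiting; last exact/fenchel_frechet/fenchel_conj.
rewrite (conj_attained h); case: (ht f x) (ht_gtNy x fNy) => [a| |] // _.
by rewrite -EFinB ltry.
Qed.

Lemma limiting_conj_env f : op_restr (limiting setT (conj_fun (ht f))) Ys =
  op_add Dphis (op_scale lam
    (limiting Ys (fun eta => - left_env phi lam f (G eta))%E)).
Proof.
have oYs : open Ys by exact: open_interior.
have gD c zeta : Ys zeta -> has_gradient (fun z => c * fine (phis z)) zeta
    (c *: G zeta).
  by move=> /G_has_gradient/(has_gradientZ c).
have cD c eta : Ys eta ->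
    c *: G zeta @[zeta --> eta] --> c *: G eta.
  move=> etaY; apply: (@cvgZ R E E (nbhs eta) _ (cst c) G c (G eta)).
    exact: cvg_cst.
  exact: G_continuous.
apply/funext => eta; apply/seteqP; split => x.
  move=> [etaY /(limiting_open _ _ oYs etaY) h].
  have l0 : 0 < lam^-1 by rewrite invr_gt0.
  have := limiting_sum l0 (gD (- lam^-1)) (cD (- lam^-1) eta etaY)
            (left_env_conj f) h.
  move=> h'; exists (G eta) => //.
  exists (lam *: (lam^-1 *: x + - lam^-1 *: G eta)).
    by exists (lam^-1 *: x + - lam^-1 *: G eta).
  by apply/rowP => i; rewrite !mxE; field; exact: lt0r_neq0.
move=> [_ [etaY ->] [_ [v h <-] <-]]; split => //.
apply/(limiting_open _ _ oYs etaY).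
rewrite addrC -[G eta]scale1r.
apply: (limiting_sum lam0 (gD 1) (cD 1 eta etaY) _ h) => z zY.
by rewrite mul1r; exact: conj_left_env.
Qed.

(** The conjugate is convex, so its limiting subgradients are Fenchel subgradients,
    and [fenchel_of_conj] inverts them. *)
Lemma left_prox_eq_limiting f : proper_on X f ->
  lower_semicontinuous (ht f) -> convex_ext (ht f) ->
  op_comp (left_prox phi lam f) Dphis =
  op_restr (limiting setT (conj_fun (ht f))) Ys.
Proof.
move=> fp hl hc; have hp := ht_proper fp.
have [hNy [z0 _ z0y]] := hp.
apply/funext => eta; apply/seteqP; split.
  by apply: left_prox_subset_limiting; case: fp.
move=> x [etaY h]; rewrite left_prox_dual; split => //.
have cNy zeta : (-oo < conj_fun (ht f) zeta)%E by exact: conj_gtNy z0y.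
have [c cE] : exists c, conj_fun (ht f) eta = c%:E.
  have [_ + _] := h; case: (conj_fun _ _) (cNy eta) => [c| |] // _ _.
  by exists c.
have h' := limiting_fenchel_convex (@convex_conj _ _ _) cNy h.
have hx := fenchel_of_conj hl hc hp cE h'.
apply/ht_fenchel; split => //; apply: contrapT => xX.
have [_ /(_ z0 I)] := hx; rewrite (ht_ndom _ xX) leye_eq => /eqP z0E.
by move: z0y; rewrite z0E.
Qed.

End LegendreOperators.

(** * Subgradients of the conjugate of a coercive function *)

Section CoerciveConjugates.
Context {R : realType} {n : nat}.
Local Notation E := 'rV[R]_n.
Implicit Types (u x z a d : E) (b c r s : R).
Context {p : E -> \bar R} (p_lsc : lower_semicontinuous p)
  (p_proper : proper_on setT p) (p_coercive : one_coercive p).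

Let p_gtNy x : (-oo < p x)%E. Proof. by case: p_proper => + _; apply. Qed.

Lemma tilted_growth u c : 0 <= c -> exists b, forall z,
  ((c * `|z| - b)%:E <= p z + (0 + dot (- u) z)%:E)%E.
Proof.
move=> c0; have c'0 : 0 <= n%:R * `|u| + c by rewrite addr_ge0 ?mulr_ge0.
have [b hb] := one_coercive_growth (n%:R * `|u| + c) p_lsc p_gtNy p_coercive.
exists b => z; have := hb z; case: (p z) => [r| |] //; last by move=> _; rewrite leey.
rewrite -EFinD !lee_fin dotNl add0r.
have := dot_le_norm u z; rewrite ler_norml => /andP[_ h1].
have := ler_wpM2l c'0 (norm_le_enorm z); rewrite mulrDl; lra.
Qed.

Let tilted_lsc u : lower_semicontinuous (fun z => p z + (0 + dot (- u) z)%:E)%E.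
Proof. by apply: lscD => //; exact: affine_continuous. Qed.

Lemma tilted_minimizer u a :
  (forall z, (p a + (0 + dot (- u) a)%:E <= p z + (0 + dot (- u) z)%:E)%E) ->
  fenchel setT p a u.
Proof.
move=> amin; split => // z _; have := amin z; rewrite lee_shift.
by congr (_ + _%:E <= _)%E; rewrite !dotX; ring.
Qed.

Lemma coercive_attained u : exists a, fenchel setT p a u.
Proof.
have [b hb] := tilted_growth u ler01.
have [a amin] := coercive_lsc_min (@tilted_lsc u) ltr01 hb.
by exists a; exact: tilted_minimizer.
Qed.

Lemma fenchel_real a u : fenchel setT p a u -> exists2 r, p a = r%:E &
  conj_fun p u = (dot u a - r)%:E.
Proof.
move=> au; have [_ [z0 _ z0y]] := p_proper; have [_ /(_ z0 I)] := au.
rewrite (conj_attained au).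
case: (p a) (p_gtNy a) => [r| |] // _; first by exists r.
by rewrite leye_eq; case: (p z0) z0y.
Qed.

Lemma argmax_compact u : compact [set a | fenchel setT p a u].
Proof.
have [a0 /[dup] a0u /fenchel_real[r ra ca]] := coercive_attained u.
have [b hb] := tilted_growth u ler01.
have -> : [set a | fenchel setT p a u] =
    [set z | (p z + (0 + dot (- u) z)%:E <= (r - dot u a0)%:E)%E].
  apply/seteqP; split => a /=.
    move=> /fenchel_real[r' ra' ca']; rewrite ra' -EFinD lee_fin dotNl.
    by move: ca'; rewrite ca => -[]; lra.
  move=> ale; apply: tilted_minimizer => z; apply: le_trans ale _.
  have [_ /(_ z I)] := a0u; rewrite ra; case: (p z) => [q| |] //.
    by rewrite -!EFinD !lee_fin !dotX; lra.
  by move=> _; rewrite leey.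
apply: (subclosed_compact _ (@compact_norm_le R n (r - dot u a0 + b))).
  exact: lsc_closed_le.
move=> z /= /(le_trans (hb z)); rewrite lee_fin; lra.
Qed.

(** For small s > 0 let a_s maximise <u + s d, .> - p. Comparing the value of the
    conjugate at u + s d with its values at u and with the slope x gives
    <d, a_s - x> >= 0, and a_s stays bounded and is a maximiser at u up to O(s).
    A minimiser of p - <u, .> over the half-space {<d, . - x> >= 0} does at least
    as well as every a_s, so it is an exact maximiser at u. *)
Lemma fenchel_conj_support u x d : fenchel setT (conj_fun p) u x ->
  exists2 a, fenchel setT p a u & 0 <= dot d (a - x).
Proof.
move=> [_ hx].
have [a0 /fenchel_real[r0 _]] := coercive_attained u.
set c := dot u a0 - r0 => cE.
pose H := [set z : E | 0 <= - dot d x + dot d z].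
have cH : closed H.
  apply: (@closed_comp _ _ (fun z : E => - dot d x + dot d z) [set s | 0 <= s]).
    by move=> z _; exact: affine_continuous.
  exact: closed_ge.
pose q := extend H (fun z => p z + (0 + dot (- u) z)%:E)%E.
have c0 : 0 < n%:R * `|d| + 1 by rewrite ltr_wpDl // mulr_ge0.
have [b hb] := tilted_growth u (ltW c0).
(* The growth rate n |d| + 1 leaves room for the slope s d with s <= 1. *)
have hq z : (((n%:R * `|d| + 1) * `|z| - b)%:E <= q z)%E.
  by rewrite /q /extend; case: ifP => _; [exact: hb|rewrite leey].
have [a amin] := coercive_lsc_min (lsc_extend (@tilted_lsc u) cH) c0 hq.
(* B bounds every a_s, so s K bounds s <d, a_s - x>. *)
pose B := Num.max 0 (b - c + n%:R * `|d| * `|x|).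
pose K := n%:R * `|d| * (B + `|x|).
have K0 : 0 <= K.
  by rewrite /K mulr_ge0 ?mulr_ge0 // addr_ge0 // /B le_max lexx.
have qa s : 0 < s -> s <= 1 -> (q a <= (- c + s * K)%:E)%E.
  move=> s0 s1.
  have [as_ /[dup] hs /fenchel_real[r rs cs]] := coercive_attained (u + s *: d).
  have := hx (u + s *: d) I.
  have -> : u + s *: d - u = s *: d by rewrite addrAC subrr add0r.
  rewrite cE cs -EFinD lee_fin dotZr dotDl dotZl (dotC x) => h1.
  have := conj_ge_fin u rs; rewrite cE lee_fin => h2.
  have ds : 0 <= dot d as_ - dot d x by rewrite -(pmulr_rge0 _ s0); lra.
  have Hs : H as_ by rewrite /H /=; lra.
  have dn : dot d as_ - dot d x <= n%:R * `|d| * (`|as_| + `|x|).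
    rewrite -dotNr -dotDr; have := dot_le_norm d (as_ - x).
    rewrite ler_norml => /andP[_ /le_trans]; apply.
    by rewrite ler_wpM2l ?mulr_ge0 // ler_normB.
  have s_le : s * (dot d as_ - dot d x) <= dot d as_ - dot d x.
    by rewrite ler_piMl.
  have as_B : `|as_| <= B.
    rewrite /B le_max; apply/orP; right.
    have := hb as_; rewrite rs -EFinD lee_fin dotNl.
    by move: dn; rewrite mulrDr mulrDl mul1r; lra.
  apply: le_trans (amin as_) _.
  rewrite /q /extend mem_set // rs -EFinD lee_fin dotNl add0r.
  have : s * (dot d as_ - dot d x) <= s * K.
    rewrite ler_pM2l //; apply: le_trans dn _.
    by rewrite /K ler_wpM2l ?mulr_ge0 // lerD2r.
  lra.
have [aH aq] : H a /\ (p a + (0 + dot (- u) a)%:E <= (- c)%:E)%E.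
  have q1 := qa 1 ltr01 (lexx 1).
  have [aH|aH] := pselect (H a); last first.
    by move: q1; rewrite /q /extend memNset // leye_eq.
  split => //; have qE : q a = (p a + (0 + dot (- u) a)%:E)%E.
    by rewrite /q /extend mem_set.
  rewrite -qE; case: (q a) q1 qa => [r| |] // _ qa; last by rewrite leNye.
  rewrite lee_fin leNgt; apply/negP => cr.
  have rc : 0 < r + c by lra.
  have [s /andP[s0 s1] sK] := small_step rc K0.
  by have := qa s s0 s1; rewrite lee_fin; lra.
exists a; last by rewrite dotDr dotNr addrC.
apply: tilted_minimizer => z; apply: le_trans aq _.
have := conj_ge p u z; rewrite cE; case: (p z) (p_gtNy z) => [r| |] // _.
  by rewrite -EFinB -EFinD !lee_fin dotNl; lra.
by rewrite leey.
Qed.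

Lemma fenchel_conj_sub_conv u x : fenchel setT (conj_fun p) u x ->
  smallest (@convex_set R E) [set a | fenchel setT p a u] x.
Proof.
by move=> hx; apply: conv_of_support => [|d]; [exact: argmax_compact|
  exact: fenchel_conj_support].
Qed.

Lemma coercive_conj_fin u : exists r, conj_fun p u = r%:E.
Proof.
have [a /fenchel_real[r _ ->]] := coercive_attained u.
by exists (dot u a - r).
Qed.


End CoerciveConjugates.

(** * The proximal hull *)

Section ProximalHull.
Context {R : realType} {n : nat}.
Local Notation E := 'rV[R]_n.
Implicit Types (u v w x y z eta zeta d : E) (e r s t : R).
Context {phi : E -> \bar R} (phi_dgf : dgf phi).
Context {lam : R} (lam0 : 0 < lam).
Implicit Types (f : E -> \bar R).

Local Notation X := (dom phi).
Local Notation Y := (intdom phi).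

Let D x y : R := lam^-1 * (fine (phi x) - fine (phi y) - dot (grad phi y) (x - y)).

Let objE f x y : X x -> Y y -> left_objective phi lam f y x = (f x + (D x y)%:E)%E.
Proof. by move=> xX yY; rewrite /left_objective bregman_fin // -EFinM. Qed.

Let lee_opp_shift (a c : \bar R) r : (- c <= - a + r%:E)%E = (a <= c + r%:E)%E.
Proof.
case: a c => [a| |] [c| |]; rewrite ?leey ?leNye //.
by rewrite -!EFinN -!EFinD !lee_fin; apply/idP/idP; lra.
Qed.

Let lee_subr_addl (a c : \bar R) r : (a <= c + (- r)%:E)%E = (a + r%:E <= c)%E.
Proof.
by rewrite -[X in (X <= _)%E]adde0 lee_shift sub0r opprK.
Qed.

Let lee_chain (a b c : \bar R) r s :
  (a <= b + s%:E)%E -> (b + r%:E <= c)%E -> (a + (r - s)%:E <= c)%E.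
Proof.
case: a b c => [a| |] [b| |] [c| |]; rewrite ?leey ?leNye //.
by rewrite -!EFinD !lee_fin; lra.
Qed.

Lemma left_env_le f x y : X x -> Y y ->
  (left_env phi lam f y <= f x + (D x y)%:E)%E.
Proof. by move=> xX yY; rewrite -objE //; apply: ge_ereal_inf; eexists; [exists x|]. Qed.

(** The two signs in the definition of the hull cancel: it is the supremum over y of
    left_env y - D(., y), hence the least function above all of these. *)
Lemma left_hull_le f x (c : \bar R) : X x ->
  (left_hull phi lam f x <= c)%E <->
  forall y, Y y -> (left_env phi lam f y <= c + (D x y)%:E)%E.
Proof.
move=> xX; rewrite /left_hull leeNl.
have E y : Y y -> (- c <= right_objective phi lam (fun y => - left_env phi lam f y) x y)%E =
    (left_env phi lam f y <= c + (D x y)%:E)%E.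
  move=> yY; rewrite /right_objective bregman_fin // -EFinM -/(D x y).
  exact: lee_opp_shift.
split=> [/ereal_infP h y yY|h].
  by rewrite -E //; apply: h; exists y.
by apply/ereal_infP => _ [y yY <-]; rewrite E //; exact: h.
Qed.

Lemma left_hull_le_fun f x : X x -> (left_hull phi lam f x <= f x)%E.
Proof. by move=> xX; apply/left_hull_le => // y yY; exact: left_env_le. Qed.

Lemma left_env_le_hull f x y : X x -> Y y ->
  (left_env phi lam f y <= left_hull phi lam f x + (D x y)%:E)%E.
Proof.
move=> xX yY; have [h _] := left_hull_le f (left_hull phi lam f x) xX.
exact: h (lexx _) y yY.
Qed.

(** The hull lies below f and its objective stays above the envelope of f, which f
    attains at x. *)
Lemma left_prox_sub_hull f y :
  left_prox phi lam f y `<=` left_prox phi lam (left_hull phi lam f) y.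
Proof.
move=> x [yY [xX xmin]]; split => //; split => // z zX.
rewrite !objE //; apply: le_trans (left_env_le_hull f zX yY).
apply: (@le_trans _ _ (f x + (D x y)%:E)%E).
  by rewrite leeD2r // left_hull_le_fun.
rewrite -objE //; apply/ereal_infP => _ [w wX <-]; exact: xmin.
Qed.

(** Being a minimiser of the hull objective is a family, over y', of bounds on
    D(w, y) - D(w, y'), which is affine in w. *)
Lemma left_prox_hull_convex f y :
  @convex_set R E (left_prox phi lam (left_hull phi lam f) y).
Proof.
apply: convex_setI => x1 x2 t [yY [x1X h1]] [_ [x2X h2]] t0 t1.
have xX := dom_convex phi_dgf x1X x2X t0 t1.
set x := t *: x1 + (1 - t) *: x2 in xX *.
split => //; split => // z zX.
rewrite objE //; set c := left_objective _ _ _ _ z.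
have below w y' : X w -> Y y' -> (left_objective phi lam (left_hull phi lam f) y w
      <= left_objective phi lam (left_hull phi lam f) y z)%E ->
    (left_env phi lam f y' + (D w y - D w y')%:E <= c)%E.
  by move=> wX y'Y; rewrite objE // => /(lee_chain (left_env_le_hull f wX y'Y)).
rewrite -lee_subr_addl; apply/left_hull_le => // y' y'Y.
rewrite -addeA -EFinD.
have -> : - D x y + D x y' = - (D x y - D x y') by ring.
rewrite lee_subr_addl.
have Daff : D x y - D x y' =
    t * (D x1 y - D x1 y') + (1 - t) * (D x2 y - D x2 y').
  rewrite /D /x; move: (grad phi y) (grad phi y') => dy dy'.
  by rewrite !dotX; ring.
have [le12|le21] := leP (D x1 y - D x1 y') (D x2 y - D x2 y').
  apply: le_trans (below x2 y' x2X y'Y (h2 z zX)); rewrite leeD2l // lee_fin Daff.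
  by have := ler_wpM2l t0 le12; lra.
apply: le_trans (below x1 y' x1X y'Y (h1 z zX)); rewrite leeD2l // lee_fin Daff.
have t1' : 0 <= 1 - t by lra.
by have := ler_wpM2l t1' (ltW le21); lra.
Qed.

Lemma conv_left_prox_sub_hull f y :
  op_conv (left_prox phi lam f) y `<=` left_prox phi lam (left_hull phi lam f) y.
Proof.
apply: smallest_sub; first exact: left_prox_hull_convex.
exact: left_prox_sub_hull.
Qed.

Context (phi_leg : legendre phi) (phi_coercive : one_coercive phi).
Context {G : E -> E} (GE : G = grad (conj_fun phi)).
Local Notation phis := (conj_fun phi).
Local Notation ht f := (fun x => phi x + lam%:E * extend X f x)%E.

Let phi_lsc : lower_semicontinuous phi. Proof. by case: phi_dgf. Qed.
Let phi_proper : proper_on setT phi. Proof. by case: phi_dgf. Qed.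

Lemma one_coercive_intdom_conj eta : intdom phis eta.
Proof.
rewrite /intdom (_ : dom phis = setT) ?interiorT //.
apply/seteqP; split => // zeta _; rewrite /dom /=.
by have [r ->] := coercive_conj_fin phi_lsc phi_proper phi_coercive zeta; rewrite ltry.
Qed.

(** Comparing the hull objective at x with that of a maximiser a, and bounding the
    hull below by left_env at every grad phis zeta, says that x is a subgradient
    at eta of the conjugate of phi + lam f. Coercivity of phi makes every zeta
    available. *)
Lemma left_prox_hull_sub_conv f eta :
  (forall x, X x -> (-oo < f x)%E) -> lower_semicontinuous (ht f) ->
  one_coercive (ht f) ->
  left_prox phi lam (left_hull phi lam f) (G eta) `<=`
    op_conv (left_prox phi lam f) (G eta).
Proof.
move=> fNy hl hco x xhull.
have YsT := one_coercive_intdom_conj; have etaY := YsT eta.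
have yY : Y (G eta) by rewrite GE; exact: grad_conj_intdom.
have [_ [xX xmin]] := xhull.
have [[x0 x0X fx0]|fy] := pselect (exists2 x0, X x0 & (f x0 < +oo)%E); last first.
  have fE z : X z -> f z = +oo%E.
    move=> zX; apply/eqP; rewrite -leye_eq leNgt; apply/negP => zy.
    by apply: fy; exists z.
  apply: sub_gen_smallest; split => //; split => // z zX.
  by rewrite !objE // !fE.
have hp : proper_on setT (ht f) by apply: ht_proper => //; split => //; exists x0.
have proxE z : left_prox phi lam f (G eta) z <-> fenchel setT (ht f) z eta.
  have GK : grad phi (G eta) = eta by rewrite GE; exact: grad_conjK.
  split.
    by move=> /(left_proxP phi_dgf lam0)[_]; rewrite GK => /(ht_fenchel phi_dgf lam0)[].
  move=> hz; apply/(left_proxP phi_dgf lam0); split => //; rewrite GK.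
  apply/(ht_fenchel phi_dgf lam0); split => //; apply: contrapT => zX.
  have [r] := fenchel_real hp hz; by rewrite (ht_ndom phi_dgf lam0 f zX).
have -> : op_conv (left_prox phi lam f) (G eta) =
    smallest (@convex_set R E) [set z | fenchel setT (ht f) z eta].
  by rewrite /op_conv; congr smallest; apply/seteqP; split => z /proxE.
apply: fenchel_conj_sub_conv => //; split => // zeta _.
have [a aeta] := coercive_attained hl hp hco eta.
have [r ra ceta] := fenchel_real hp aeta.
have [_ [aX amin]] := (proxE a).2 aeta.
have DE w theta : X w -> D w (G theta) =
    lam^-1 * (fine (phi w) + fine (phis theta) - dot theta w).
  move=> wX; have thetaY : Y (G theta) by rewrite GE; exact: grad_conj_intdom.
  have : bregman phi w (G theta) = (fine (phi w) + fine (phis theta) - dot theta w)%:E.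
    by rewrite GE; exact: bregman_conj.
  by rewrite (bregman_fin phi_dgf wX thetaY) => -[e]; rewrite /D e.
have zetaY : Y (G zeta) by rewrite GE; exact: grad_conj_intdom.
have [c czeta] := coercive_conj_fin hl hp hco zeta.
have envE : left_env phi lam f (G zeta) = (lam^-1 * (fine (phis zeta) - c))%:E.
  have := left_env_conj phi_dgf phi_leg lam0 GE f (YsT zeta).
  rewrite czeta -EFinM -EFinD => /(congr1 (@oppe R)); rewrite oppeK => ->.
  by rewrite -EFinN; congr _%:E; ring.
have [q fa] : exists q, f a = q%:E.
  move: ra; rewrite (ht_dom f aX) (dom_fin phi_dgf aX).
  have l0 : (0 < lam%:E)%E by rewrite lte_fin.
  case: (f a) => [q| |]; [by exists q|by rewrite gt0_muley|by rewrite gt0_muleNy].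
have rE : r = fine (phi a) + lam * q.
  move: ra; rewrite (ht_dom f aX) (dom_fin phi_dgf aX) fa.
  by rewrite -EFinM -EFinD => -[].
have obj_xa : (left_hull phi lam f x + (D x (G eta))%:E <= f a + (D a (G eta))%:E)%E.
  rewrite -objE //; apply: le_trans (xmin a aX) _.
  by rewrite objE // leeD2r // left_hull_le_fun.
have := lee_chain (left_env_le_hull f xX zetaY) obj_xa.
rewrite envE fa -!EFinD lee_fin !DE // ceta czeta -EFinD lee_fin rE => main.
have {main} := ler_wpM2l (ltW lam0) main.
have -> : lam * (lam^-1 * (fine (phis zeta) - c) +
    (lam^-1 * (fine (phi x) + fine (phis eta) - dot eta x) -
     lam^-1 * (fine (phi x) + fine (phis zeta) - dot zeta x))) =
  fine (phis eta) - c - dot eta x + dot zeta x by field; exact: lt0r_neq0.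
have -> : lam * (q + lam^-1 * (fine (phi a) + fine (phis eta) - dot eta a)) =
  lam * q + (fine (phi a) + fine (phis eta) - dot eta a).
  by field; exact: lt0r_neq0.
rewrite !dotX !(dotC x); lra.
Qed.

End ProximalHull.

(** * The theorem *)

Theorem theorem3p4 (R : realType) (n : nat) (phi : 'rV[R]_n -> \bar R)
    (hphi : dgf phi) (lam : R) (hlam : 0 < lam) (f g : 'rV[R]_n -> \bar R) :
  let X := dom phi in
  let Y := intdom phi in
  let phis := conj_fun phi in
  let Ys := intdom phis in
  let Dphi := op_fun Y (grad phi) in
  let Dphis := op_fun Ys (grad phis) in
  (* phi + lam f on X, and its extension by +oo to R^n *)
  let h := (fun x => phi x + lam%:E * f x)%E in
  let ht := (fun x => phi x + lam%:E * extend X f x)%E in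
  (* g o grad phi^* on Ys *)
  let gs := (fun eta => g (grad phis eta)) in
  (* (i) *)
  (left_level phi lam f =
     op_sub
       (op_restr (fenchel X (fun x => f x + (lam^-1)%:E * phi x)%E) X°)
       (op_scale lam^-1 Dphi)
   /\ op_subset (left_level phi lam f) (frechet X f))
  (* (ii) *)
  /\ left_prox phi lam f = op_comp (op_inv (fenchel X h)) Dphi
  (* (iii) *)
  /\ op_cap X° (left_prox phi lam f) =
     op_comp (op_inv (op_add Dphi (op_scale lam (left_level phi lam f)))) Dphi
  (* (iv) *)
  /\ right_prox phi lam g =
     op_restr (op_inv (op_add op_id (op_scale lam (right_level phi lam g)))) X
  /\ (legendre phi ->
     (* (v), in the dual variable: both sides are operators on Ys *)
     (op_comp (right_level phi lam g) Dphis =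
        op_sub (fenchel Ys (fun eta => gs eta + (lam^-1)%:E * phis eta)%E)
               (op_scale lam^-1 Dphis)
      /\ op_subset (op_comp (right_level phi lam g) Dphis) (frechet Ys gs))
     (* (vi), in the dual variable: both sides are operators from X to Ys *)
     /\ op_comp Dphi (right_prox phi lam g) =
        op_restr
          (op_inv (fenchel Ys (fun eta => phis eta + lam%:E * gs eta)%E)) X
     (* (vii) *)
     /\ (op_comp (left_prox phi lam f) Dphis =
           op_restr (op_inv (fenchel X h)) Ys
         /\ (proper_on X f -> monotone_op (op_comp (left_prox phi lam f) Dphis))
         /\ (proper_on Y g -> monotone_op (op_comp Dphi (right_prox phi lam g))))
     (* (viii) *)
     /\ (((forall x, X x -> (-oo < f x)%E) ->
            op_subset (op_comp (left_prox phi lam f) Dphis)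
                      (op_restr (limiting setT (conj_fun ht)) Ys))
         /\ op_restr (limiting setT (conj_fun ht)) Ys =
            op_add Dphis
              (op_scale lam
                (limiting Ys
                  (fun eta => - left_env phi lam f (grad phis eta))%E))
         /\ (proper_on X f -> lower_semicontinuous ht -> convex_ext ht ->
            op_comp (left_prox phi lam f) Dphis =
            op_restr (limiting setT (conj_fun ht)) Ys))
     (* (ix) *)
     /\ (one_coercive phi ->
         op_subset
           (op_comp (op_conv (left_prox phi lam f)) Dphis)
           (op_comp (left_prox phi lam (left_hull phi lam f)) Dphis)
         /\ ((forall x, X x -> (-oo < f x)%E) ->
             lower_semicontinuous ht -> one_coercive ht ->
             op_comp (op_conv (left_prox phi lam f)) Dphis =
             op_comp (left_prox phi lam (left_hull phi lam f)) Dphis))).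
Proof.
move=> X Y phis Ys Dphi Dphis h ht gs.
split; first split.
- exact: left_level_fenchel.
- exact: left_level_subset_frechet.
split; first exact: left_prox_fenchel.
split; first exact: intdom_left_prox.
split; first exact: right_prox_level.
move=> phi_leg; split; first split.
- exact: right_level_fenchel.
- exact: right_level_subset_frechet.
split; first exact: right_prox_fenchel.
split.
  split; first exact: left_prox_dual.
  split; first exact: left_prox_monotone.
  exact: right_prox_monotone.
split.
  split; first exact: left_prox_subset_limiting.
  split; first exact: limiting_conj_env.
  exact: left_prox_eq_limiting.
move=> phi_coercive.
have sub : op_subset (op_comp (op_conv (left_prox phi lam f)) Dphis)
    (op_comp (left_prox phi lam (left_hull phi lam f)) Dphis).
  move=> eta x [y etay xy]; exists y => //.
  exact: conv_left_prox_sub_hull.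
split=> // fNy ht_lsc ht_coercive.
apply/funext => eta; apply/seteqP; split; first exact: sub.
move=> x [y [etaY ->] xy]; exists (grad phis eta) => //.
exact: left_prox_hull_sub_conv xy.
Qed.
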